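(* Let $n\ge 1$, let $\mu$ be a Borel probability measure on $\mathbb{R}^n$, and let $T:\mathbb{R}^n\to\mathbb{R}^n$ be a $1$-Lipschitz map (Euclidean norm). Then for every $s>0$, every integer $k\ge\lceil n/2\rceil$, and every internal energy $\mathcal{U}$ in the pressure class $\mathcal{PC}_k$, $$\mathcal{U}(\mu*\gamma_s)\le\mathcal{U}(T_\#\mu*\gamma_s).$$
   Context: $\gamma_s(x)=(2\pi s)^{-n/2}e^{-\|x\|_2^2/(2s)}$ is the Gaussian density with variance $s$ on $\mathbb{R}^n$; $\mu*\gamma_s$ denotes the density $x\mapsto\int\gamma_s(x-y)\,d\mu(y)$; $T_\#\mu$ is the push-forward. Internal energy: an energy density is a measurable function $U:[0,\infty)\to\mathbb{R}$ with $U(0)=0$; the corresponding internal energy is $\mathcal{U}(\rho)=\int_{\mathbb{R}^n}U(\rho(x))\,dx$ for probability densities $\rho$ on $\mathbb{R}^n$ for which the integral is defined, with values in $[-\infty,+\infty]$. Pressure: if $U$ is convex, its pressure law is $P:[0,\infty)\to\mathbb{R}$, $P(0)=0$ and $P(\rho)=\rho\,U'_+(\rho)-U(\rho)$ for $\rho>0$, where $U'_+$ is the right derivative. Pressure classes: for $c\ge1$ and $F:[0,\infty)\to\mathbb{R}$ put $\Delta_cF(\rho)=F(c\rho)-F(\rho)$. For an integer $k\ge1$, $\mathcal{PC}_k$ is the class of energy densities $U$ that are convex and whose pressure law satisfies $\Delta_{c_1}\cdots\Delta_{c_k}P(\rho)\ge0$ for all $\rho\ge0$ and all $c_1,\dots,c_k\ge1$.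 An internal energy belongs to $\mathcal{PC}_k$ if its energy density does. *)

(* Defs.v *)
From HB Require Import structures.
From mathcomp Require Import all_boot all_order all_algebra.
From mathcomp Require Import all_classical all_reals all_analysis.

Set Implicit Arguments.
Unset Strict Implicit.
Unset Printing Implicit Defensive.

Import Order.TTheory GRing.Theory Num.Theory.
Import numFieldNormedType.Exports.

Local Open Scope classical_set_scope.
Local Open Scope ring_scope.

(* R^n is 'rV[R]_n with its Borel sigma-algebra.  The norm that the library   *)
(* puts on 'rV[R]_n is the sup norm: same topology as the Euclidean one, but  *)
(* the Euclidean norm itself is l2norm below.                                 *)
Section borel_rV.
Context {R : realType} (n : nat).

HB.instance Definition _ :=
  @isMeasurable.Build (sigma_display (@open 'rV[R]_n)) 'rV[R]_n
    <<s @open 'rV[R]_n >>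
    (@sigma_algebra0 _ setT _)
    (@measurableC _ (g_sigma_algebraType (@open 'rV[R]_n)))
    (@sigma_algebra_bigcup _ setT _).

End borel_rV.

Lemma measurable_fun_rV d (X : measurableType d) (R : realType) (n : nat)
    (f : X -> 'rV[R]_n) :
  (forall i, measurable_fun [set: X] (fun x => f x ord0 i)) ->
  measurable_fun [set: X] f.
Proof.
move=> mf; apply: (measurability (@open 'rV[R]_n)) => // _ [U oU <-].
rewrite setTI.
pose box (q : 'rV[rat]_n * 'rV[rat]_n) : set 'rV[R]_n :=
  [set v | forall i, ratr (q.1 ord0 i) < v ord0 i < ratr (q.2 ord0 i)].
have -> : f @^-1` U =
    \bigcup_(q in [set q | box q `<=` U]) (f @^-1` (box q)).
  apply/seteqP; split => [x Ufx|x [q qU bq]]; last exact: qU.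
  have : nbhs (f x) U by move/open_nbhs_nbhs : (conj oU Ufx).
  move=> [P nP PU].
  have H i : exists q : rat * rat, ratr q.1 < f x ord0 i < ratr q.2 /\
      forall r, ratr q.1 < r < ratr q.2 -> P ord0 i r.
    have /nbhs_ballP [e /= e0 eP] := nP ord0 i.
    have [a /[!in_itv]/= /andP[a1 a2]] :=
      @rat_in_itvoo R _ _ (ltac:(by rewrite ltrBlDr ltrDl) :
        f x ord0 i - e < f x ord0 i).
    have [b /[!in_itv]/= /andP[b1 b2]] :=
      @rat_in_itvoo R _ _ (ltac:(by rewrite ltrDl) :
        f x ord0 i < f x ord0 i + e).
    exists (a, b); split; first by rewrite /= a2 b1.
    move=> r /= /andP[ar rb]; apply: eP; rewrite /ball/= distrC ltr_distl.
    by rewrite (lt_trans a1 ar) (lt_trans rb b2).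
  have [g Hg] := choice H.
  exists (\row_i (g i).1, \row_i (g i).2).
    move=> v /= bv; apply: PU => i j; rewrite (ord1 i).
    by apply: (Hg j).2; move: (bv j); rewrite !mxE.
  by move=> i /=; rewrite !mxE; exact: (Hg i).1.
rewrite bigcup_mkcond; apply: countable_bigcupT_measurable.
  exact: countableP.
move=> q; case: ifPn => // _.
have -> : f @^-1` (box q) = \bigcap_(i in [set: 'I_n])
    ((fun x => f x ord0 i) @^-1`
      `]ratr (q.1 ord0 i), ratr (q.2 ord0 i)[%classic).
  apply/seteqP; split => [x bx i _|x bx i] /=.
    by rewrite in_itv/=; exact: bx.
  by have := bx i I; rewrite /= in_itv.
apply: fin_bigcap_measurable => // i _.
by rewrite -[X in measurable X]setTI; apply: mf => //; exact: measurable_itv.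
Qed.

Lemma measurable_coord_rV (R : realType) (n : nat) (i : 'I_n) :
  measurable_fun [set: 'rV[R]_n]
    (fun v : 'rV[R]_n => v ord0 i : measurableTypeR R).
Proof.
apply: (measurability _ (measurable_realfun.RGenOpens.measurableE R)).
move=> _ [_ [a [b ->]] <-].
rewrite setTI; apply: sub_sigma_algebra.
apply: open_comp; last exact: interval_open.
by move=> v _; exact: coord_continuous.
Qed.

Section lebesgue_rV.
Context {R : realType}.

Definition cons_rV n (x : measurableTypeR R * 'rV[R]_n) : 'rV[R]_n.+1 :=
  row_mx (x.1)%:M x.2.

Lemma cons_rV0 n x : @cons_rV n x ord0 (lshift n (ord0 : 'I_1)) = x.1.
Proof.
by apply: etrans (@row_mxEl R 1 1 n x.1%:M x.2 ord0 ord0) _; rewrite mxE.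
Qed.

Lemma cons_rVS n x (i : 'I_n) : @cons_rV n x ord0 (rshift 1 i) = x.2 ord0 i.
Proof. exact: (@row_mxEr R 1 1 n x.1%:M x.2 ord0 i). Qed.

Definition uncons_rV n (v : 'rV[R]_n.+1) : measurableTypeR R * 'rV[R]_n :=
  (v ord0 ord0, @rsubmx _ 1 1 n v).

Lemma cons_rVK n : cancel (@cons_rV n) (@uncons_rV n).
Proof.
move=> [x v]; congr pair; last by rewrite /cons_rV row_mxKr.
rewrite (_ : @ord0 n = lshift n (ord0 : 'I_1)); last exact: val_inj.
exact: cons_rV0.
Qed.

Lemma measurable_cons_rV n : measurable_fun setT (@cons_rV n).
Proof.
apply: measurable_fun_rV => i; case: (@split_ordP 1 n i) => j ->.
  rewrite (_ : (fun _ => _) = fst); first exact: measurable_fst.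
  by apply/funext => x; rewrite (ord1 j) cons_rV0.
rewrite (_ : (fun _ => _) = (fun v : 'rV[R]_n => v ord0 j) \o snd).
  by apply: measurableT_comp => //; exact: measurable_coord_rV.
by apply/funext => x; exact: cons_rVS.
Qed.

Lemma measurable_uncons_rV n : measurable_fun setT (@uncons_rV n).
Proof.
apply/measurable_fun_pairP; split; first exact: measurable_coord_rV.
apply: measurable_fun_rV => i /=.
rewrite (_ : (fun _ => _) = fun v : 'rV[R]_n.+1 => v ord0 (rshift 1 i)).
  exact: measurable_coord_rV.
by apply/funext => v; rewrite mxE.
Qed.

Section cons_measure.
Local Open Scope ereal_scope.
Variables (n : nat) (mu : {sigma_finite_measure set 'rV[R]_n -> \bar R}).

Definition cons_measure : set 'rV[R]_n.+1 -> \bar R :=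
  pushforward (lebesgue_measure \x mu) (@cons_rV n).

HB.instance Definition _ := Measure.copy cons_measure
  (measure_function_pushforward__canonical__measure_function_Measure
    (lebesgue_measure \x mu) (@measurable_cons_rV n)).

Let cons_measure_sigma_finite : sigma_finite setT cons_measure.
Proof.
suff [F TF Foo] : sigma_finite setT (lebesgue_measure \x mu).
  exists (fun k => @uncons_rV n @^-1` F k).
    by rewrite -preimage_bigcup -TF preimage_setT.
  move=> k; have [mF Fk] := Foo k; split.
    by rewrite -[X in measurable X]setTI; exact: measurable_uncons_rV.
  rewrite /cons_measure /pushforward -comp_preimage.
  by rewrite (_ : _ \o _ = id) ?preimage_id//; apply/funext/cons_rVK.
have /sigma_finiteP[F [TF ndF Foo]] := sigma_finiteT (@lebesgue_measure R).
have /sigma_finiteP[G [TG ndG Goo]] := sigma_finiteT mu.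
exists (fun k => F k `*` G k).
  rewrite -setXTT TF TG; apply/seteqP; split => [[x y]|[x y] [k _ [/= ? ?]]].
    move=> [/= [k _ Fkx] [l _ Gly]]; exists (maxn k l) => //; split.
    - by move: x Fkx; exact/subsetPset/ndF/leq_maxl.
    - by move: y Gly; exact/subsetPset/ndG/leq_maxr.
  by split; exists k.
move=> k; have [? ?] := Foo k; have [? ?] := Goo k; split.
  exact: measurableX.
by rewrite product_measure1E// lte_mul_pinfty// ge0_fin_numE.
Qed.

HB.instance Definition _ :=
  Measure_isSigmaFinite.Build _ _ _ cons_measure cons_measure_sigma_finite.

End cons_measure.

Fixpoint lebesgue_rV n : set 'rV[R]_n -> \bar R :=
  match n with
  | 0 => dirac (0 : 'rV[R]_0)
  | n'.+1 => pushforward (lebesgue_measure \x @lebesgue_rV n')%E (@cons_rV n')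
  end.

Let lebesgue_rV_ex n :
  exists mu : {sigma_finite_measure set 'rV[R]_n -> \bar R},
    mu = @lebesgue_rV n :> (set 'rV[R]_n -> \bar R).
Proof.
elim: n => [|n [mu muE]].
  by exists (@dirac _ 'rV[R]_0 0 R : {sigma_finite_measure set _ -> \bar R}).
exists (cons_measure mu : {sigma_finite_measure set _ -> \bar R}).
by rewrite /= -muE.
Qed.

Section lebesgue_rV_measure.
Variable n : nat.

Let lebesgue_rV0 : @lebesgue_rV n set0 = 0%E.
Proof. by have [mu <-] := lebesgue_rV_ex n. Qed.

Let lebesgue_rV_ge0 A : (0 <= @lebesgue_rV n A)%E.
Proof. by have [mu <-] := lebesgue_rV_ex n. Qed.

Let lebesgue_rV_sigma_additive : semi_sigma_additive (@lebesgue_rV n).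
Proof.
by have [mu <-] := lebesgue_rV_ex n; exact: measure_semi_sigma_additive.
Qed.

HB.instance Definition _ := isMeasure.Build _ _ _ (@lebesgue_rV n)
  lebesgue_rV0 lebesgue_rV_ge0 lebesgue_rV_sigma_additive.

Let lebesgue_rV_sigma_finite : sigma_finite setT (@lebesgue_rV n).
Proof. by have [mu <-] := lebesgue_rV_ex n; exact: sigma_finiteT. Qed.

HB.instance Definition _ := Measure_isSigmaFinite.Build _ _ _ (@lebesgue_rV n)
  lebesgue_rV_sigma_finite.

End lebesgue_rV_measure.

End lebesgue_rV.
Arguments lebesgue_rV {R} n : simpl never.

Lemma lebesgue_rV_box (R : realType) (n : nat)
    (A : 'I_n -> set (measurableTypeR R)) :
  (forall i, measurable (A i)) ->
  lebesgue_rV n [set v : 'rV[R]_n | forall i, A i (v ord0 i)] =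
  (\prod_(i < n) lebesgue_measure (A i))%E.
Proof.
elim: n A => [|n IHn] A mA.
  rewrite big_ord0 /lebesgue_rV diracE mem_set//.
  by case.
rewrite big_ord_recl -IHn// -product_measure1E//; last first.
  have -> : [set v : 'rV[R]_n | forall i, A (lift ord0 i) (v ord0 i)] =
      \bigcap_(i in [set: 'I_n]) ((fun v => v ord0 i) @^-1` A (lift ord0 i)).
    by apply/seteqP; split => [v vA i _|v vA i]; [exact: vA|exact: (vA i I)].
  apply: fin_bigcap_measurable => // i _.
  by rewrite -[X in measurable X]setTI; exact: measurable_coord_rV.
rewrite [LHS]/lebesgue_rV/= /pushforward; congr (product_measure1 _ _ _).
have e0 : lshift n (ord0 : 'I_1) = ord0 :> 'I_n.+1 by exact: val_inj.
have eS i : rshift 1 i = lift ord0 i :> 'I_n.+1 by exact: val_inj.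
apply/seteqP; split => [x xA|x [x0 xS] i] /=.
  split=> [|i] /=; first by have := xA ord0; rewrite -e0 cons_rV0.
  by have := xA (lift ord0 i); rewrite -{2}eS cons_rVS.
case: (unliftP ord0 i) => [j ->|->]; last by rewrite -e0 cons_rV0 e0.
by rewrite -eS cons_rVS eS; exact: xS.
Qed.

Section internal_energy.
Context {R : realType}.

Definition l2norm n (x : 'rV[R]_n) : R := Num.sqrt (\sum_(i < n) x ord0 i ^+ 2).

Definition lipschitz1 n (T : 'rV[R]_n -> 'rV[R]_n) : Prop :=
  forall x y, l2norm (T x - T y) <= l2norm (x - y).

Definition gauss n (s : R) (x : 'rV[R]_n) : R :=
  (2 * pi * s) `^ (- (n%:R / 2)) * expR (- (l2norm x ^+ 2 / (2 * s))).

(* mu is only a set function here so that the definition applies to           *)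
(* pushforward mu T without carrying a proof that T is measurable.            *)
Definition conv_gauss n (mu : set 'rV[R]_n -> \bar R) (s : R)
    (x : 'rV[R]_n) : R :=
  fine (\int[mu]_y (gauss s (x - y))%:E)%E.

(* Functions on [0, +oo) are represented by functions on R, of which only the *)
(* values on [0, +oo) are ever used.                                          *)
Definition energy_density (U : R -> R) : Prop :=
  measurable_fun `[(0 : R), +oo[%classic U /\ U 0 = 0.

(* The library integral is \int f^+ - \int f^-.  It is the internal energy    *)
(* whenever one of the two is finite; \int f^+ is finite when U is convex     *)
(* with U 0 = 0 and rho is a bounded probability density, since then          *)
(* U r <= r / M * U M for 0 <= r <= M.                                        *)
Definition internal_energy n (U : R -> R) (rho : 'rV[R]_n -> R) : \bar R :=
  (\int[lebesgue_rV n]_x (U (rho x))%:E)%E.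

Definition right_derive (U : R -> R) (r : R) : R :=
  lim (h^-1 * (U (r + h) - U r) @[h --> 0^'+]).

Definition pressure (U : R -> R) (r : R) : R :=
  if r == 0 then 0 else r * right_derive U r - U r.

Definition Delta (c : R) (F : R -> R) (r : R) : R := F (c * r) - F r.

Definition pressure_class (k : nat) (U : R -> R) : Prop :=
  [/\ energy_density U,
      convex_function `[(0 : R), +oo[%classic U &
      forall cs : k.-tuple R, all (>= 1) cs ->
      forall r, 0 <= r -> 0 <= foldr Delta (pressure U) cs r].

End internal_energy.

(* Main.v *)
(* Idea.  With mu * gamma_s = rho, tensor with a centred Gaussian on R^2k, where
   2k >= n, and move the atom at y along the curve
   cos(th) (y, 0) + sin(th) (0, T y) of R^n x R^2k: all mutual distances decrease
   along it, and its endpoints are rho (x) gamma and (rotated) rho_T (x) gamma.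

   In R^N, let rho = sum_i w_i gamma(. - x_i) and let eta be nonincreasing. Then
     \int rho eta(ln rho) = sum_i w_i \int gamma(z) eta(ln rho(z + x_i)) dz
   depends on the x_i only through the differences x_i - x_j. Differentiating
   under the integral, translating back and symmetrizing in (i, j) gives
     - 1/(2s) sum_ij w_i w_j <x_i - x_j, x_i' - x_j'>
                \int gamma_i gamma_j eta'(ln rho) / rho,
   which is <= 0 when distances decrease. So \int rho eta(ln rho) decreases.

   Integrating out two Gaussian coordinates turns F(ln r) into
   2 pi s \int_0^oo F(ln r - ln(2 pi s) - t) dt, i.e. into a primitive in ln r.
   Hence the above applies to the k-th primitive of e^t eta(t). For
   v(t) = beta e^t - U(e^t) the finite difference D_h^k v has the form
   e^t eta(t) with eta nonincreasing, precisely because D_h^k of the pressure is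
   >= 0; its k-th primitive D_h^k (primitive^k v) is h^k times an average of v,
   and h -> 0 with Fatou's lemma yields the theorem. *)

Require Import Defs.
From mathcomp Require Import all_boot all_order all_algebra.
From mathcomp Require Import all_classical all_reals all_analysis.
From mathcomp Require Import measurable_realfun ring lra.

Set Implicit Arguments.
Unset Strict Implicit.
Unset Printing Implicit Defensive.

Import Order.TTheory GRing.Theory Num.Theory.
Import numFieldNormedType.Exports.

Local Open Scope classical_set_scope.
Local Open Scope ring_scope.

(** * Lebesgue measure and Gaussians on R^n *)

(** The dimension count fixes k. The image T y needs n coordinates of its own, orthogonal to those
    of y, so the curve runs in R^n x R^n x R^(2k - n). At each end one block R^n carries the atoms,
    and the other n + (2k - n) = 2k coordinates are Gaussian.

    Since U is merely convex and the pressure condition is stated by differences, monotonicity is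
    drawn from right derivatives and k-th derivatives are replaced by D_h^k. Differences also settle
    the behaviour at -oo. Integrating out Gaussian coordinates calls for primitives vanishing there,
    but v tends to 0 without a rate, so its primitives from -oo may diverge; D_h^j of any j-th
    primitive is h^j times a value of v and does vanish.

    Multiples of e^t are free: rho has mass 1, and e^-t D_h^k(e^t) is constant in t. They serve
    twice, to make v >= 0 on the range of ln rho and to make eta >= 0, so that Tonelli and Fatou
    apply without integrability of U(rho).

    If U(0+) < 0, then v does not tend to 0 at -oo; this case is separate, and there the energy of
    mu * gamma_s is -oo. *)

Section translation.
Context {R : realType}.
Notation leb := (@lebesgue_measure R).

Lemma lebesgue_translate (a : R) (A : set (measurableTypeR R)) : measurable A ->
  leb ((fun x : measurableTypeR R => x + a : measurableTypeR R) @^-1` A) = leb A.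
Proof.
move=> mA.
have mf : measurable_fun [set: measurableTypeR R]
   (fun x : measurableTypeR R => x + a : measurableTypeR R).
  exact: measurable_funD.
pose nu : {measure set (measurableTypeR R) -> \bar R} :=
  measure_function_pushforward__canonical__measure_function_Measure leb mf.
suff H : forall X, ocitv X -> leb X = nu X.
  by rewrite (lebesgue_measure_unique H mA).
move=> X [[x y] /= xy <-]; rewrite /nu /= /pushforward.
rewrite (_ : _ @^-1` _ = `]x - a, y - a]%classic); last first.
  by apply/seteqP; split => z /=; rewrite !in_itv/= ltrBlDr lerBrDr.
rewrite !lebesgue_measure_itv/= !lte_fin ltrD2r.
by case: ifPn => // _; rewrite -!EFinD; congr EFin; ring.
Qed.

Lemma ge0_integral_lebesgue_translate (a : R) (f : R -> \bar R) :
  measurable_fun setT f -> (forall x, 0 <= f x)%E ->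
  (\int[leb]_x f (x + a)%R = \int[leb]_x f x)%E.
Proof.
move=> mf f0.
have ma : measurable_fun [set: measurableTypeR R]
   (fun x : measurableTypeR R => x + a : measurableTypeR R).
  exact: measurable_funD.
pose nu : {measure set (measurableTypeR R) -> \bar R} :=
  measure_function_pushforward__canonical__measure_function_Measure leb ma.
rewrite [RHS](@eq_measure_integral _ _ _ _ nu).
  by rewrite ge0_integral_pushforward.
by move=> A mA _; rewrite /nu/= /pushforward lebesgue_translate.
Qed.

Lemma ge0_integral_lebesgue_rV_cons n (f : 'rV[R]_n.+1 -> \bar R) :
  measurable_fun setT f -> (forall x, 0 <= f x)%E ->
  (\int[lebesgue_rV n.+1]_x f x =
   \int[leb]_t \int[lebesgue_rV n]_v f (cons_rV (t, v)))%E.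
Proof.
move=> mf f0.
pose nu : {measure set 'rV[R]_n.+1 -> \bar R} :=
  measure_function_pushforward__canonical__measure_function_Measure
    (leb \x lebesgue_rV n)%E (@measurable_cons_rV R n).
rewrite (@eq_measure_integral _ _ _ _ nu) => [|A mA _]; last first.
  by rewrite /nu/= /lebesgue_rV.
rewrite ge0_integral_pushforward//; last exact: measurable_cons_rV.
rewrite preimage_setT fubini_tonelli1//.
by apply: measurableT_comp => //; exact: measurable_cons_rV.
by move=> x; exact: f0.
Qed.

End translation.

Section rV.
Context {R : realType}.
Notation leb := (@lebesgue_measure R).

Lemma cons_rVD n (t u : R) (v w : 'rV[R]_n) :
  cons_rV (t, v) + cons_rV (u, w) = cons_rV (t + u, v + w).
Proof.
apply/rowP => i; rewrite mxE; case: (@split_ordP 1 n i) => j ->.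
  by rewrite (ord1 j) !cons_rV0.
by rewrite !cons_rVS/= mxE.
Qed.

Lemma uncons_rVK n : cancel (@uncons_rV R n) (@cons_rV R n).
Proof.
move=> v; apply/rowP => i; case: (@split_ordP 1 n i) => j ->.
  rewrite (ord1 j) cons_rV0/=; congr (v _ _); exact: val_inj.
by rewrite cons_rVS/= mxE.
Qed.

Lemma measurable_rV_coord d (X : measurableType d) n (f : X -> 'rV[R]_n) i :
  measurable_fun setT f -> measurable_fun setT (fun x => f x ord0 i : R).
Proof.
move=> mf; apply: (measurableT_comp (measurable_coord_rV i)) mf.
Qed.

Lemma measurable_rVD d (X : measurableType d) n (f g : X -> 'rV[R]_n) :
  measurable_fun setT f -> measurable_fun setT g ->
  measurable_fun setT (fun x => f x + g x).
Proof.
move=> mf mg; apply: measurable_fun_rV => i.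
under eq_fun do rewrite mxE.
by apply: measurable_funD; exact: measurable_rV_coord.
Qed.

Lemma measurable_rVB d (X : measurableType d) n (f g : X -> 'rV[R]_n) :
  measurable_fun setT f -> measurable_fun setT g ->
  measurable_fun setT (fun x => f x - g x).
Proof.
move=> mf mg; apply: measurable_fun_rV => i.
under eq_fun do rewrite !mxE.
by apply: measurable_funB; exact: measurable_rV_coord.
Qed.

Lemma ge0_integral_lebesgue_rV_translate n (a : 'rV[R]_n)
    (f : 'rV[R]_n -> \bar R) :
  measurable_fun setT f -> (forall x, 0 <= f x)%E ->
  (\int[lebesgue_rV n]_x f (x + a)%R = \int[lebesgue_rV n]_x f x)%E.
Proof.
elim: n a f => [|n IH] a f mf f0.
  by apply: eq_integral => x _; rewrite [x + a]thinmx0 [x]thinmx0.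
rewrite (ge0_integral_lebesgue_rV_cons mf f0).
have mfa : measurable_fun setT (fun x : 'rV[R]_n.+1 => f (x + a)).
  by apply: (measurableT_comp mf); exact: measurable_rVD.
rewrite (ge0_integral_lebesgue_rV_cons mfa (fun x => f0 _)) {mfa}.
rewrite -(uncons_rVK a); case: (uncons_rV a) => b c.
have mfc t : measurable_fun setT (fun v : 'rV[R]_n => f (cons_rV (t, v))).
  apply: (measurableT_comp mf).
  by apply: (measurableT_comp (@measurable_cons_rV R n)).
under eq_integral => t _.
  under eq_integral => v _ do rewrite cons_rVD.
  rewrite (IH c (fun v => f (cons_rV (t + b, v))) (mfc _) (fun v => f0 _)).
  over.
rewrite (@ge0_integral_lebesgue_translate R b
  (fun t => \int[lebesgue_rV n]_v f (cons_rV (t, v)))%E) => [//||x].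
  apply: (measurable_fun_fubini_tonelli_F (fun tv => f (cons_rV tv))) => //.
  by apply: measurableT_comp => //; exact: measurable_cons_rV.
exact: integral_ge0.
Qed.

Lemma lebesgue_rV_translate n (a : 'rV[R]_n) (A : set 'rV[R]_n) :
  measurable A -> lebesgue_rV n ((fun x => x + a) @^-1` A) = lebesgue_rV n A.
Proof.
move=> mA.
have mA' : measurable ((fun x : 'rV[R]_n => x + a) @^-1` A).
  by rewrite -[X in measurable X]setTI; apply: measurable_rVD.
transitivity (\int[lebesgue_rV n]_x (\1_A (x + a)%R)%:E)%E.
  rewrite (_ : (fun x => _) = EFin \o \1_((fun x => x + a) @^-1` A)).
    by rewrite integral_indic// setIT.
  by apply/funext => x /=; rewrite !indicE.
rewrite (@ge0_integral_lebesgue_rV_translate n a (EFin \o \1_A))//.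
  by rewrite integral_indic// setIT.
  by apply/measurable_EFinP; exact: measurable_indic.
by move=> x; rewrite lee_fin.
Qed.

Lemma integrable_lebesgue_rV_translate n (a : 'rV[R]_n) (f : 'rV[R]_n -> R) :
  (lebesgue_rV n).-integrable setT (EFin \o f) ->
  (lebesgue_rV n).-integrable setT (fun x => (f (x + a))%:E).
Proof.
move=> /integrableP[mf fi]; apply/integrableP; split.
  by apply: (measurableT_comp mf); exact: measurable_rVD.
have := @ge0_integral_lebesgue_rV_translate n a (fun x => `|(f x)%:E|%E)
  (measurableT_comp (@abse_measurable R setT) mf) (fun=> abse_ge0 _).
by move=> ->.
Qed.

Lemma integral_lebesgue_rV_translate n (a : 'rV[R]_n)
    (f : 'rV[R]_n -> R) :
  (lebesgue_rV n).-integrable setT (EFin \o f) ->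
  (\int[lebesgue_rV n]_x f (x + a) = \int[lebesgue_rV n]_x f x)%R.
Proof.
move=> fi; have mf := (integrableP _ _ _ fi).1.
have ma : measurable_fun setT (fun x : 'rV[R]_n => x + a).
  exact: measurable_rVD.
pose nu : {measure set 'rV[R]_n -> \bar R} :=
  measure_function_pushforward__canonical__measure_function_Measure
    (lebesgue_rV n) ma.
have nuE A : measurable A -> A `<=` setT -> lebesgue_rV n A = nu A.
  by move=> mA _; rewrite /nu/= /pushforward lebesgue_rV_translate.
rewrite /Rintegral; congr fine.
rewrite [RHS](@eq_measure_integral _ _ _ _ nu)//.
by rewrite integral_pushforward//; exact: integrable_lebesgue_rV_translate.
Qed.

End rV.

Section split.
Context {R : realType}.
Notation leb := (@lebesgue_measure R).

(** The dimensions a.+1 + b and (a + b).+1 are convertible, but the shifted indices agree only in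
    value; hence the detours through [val_inj]. *)
Lemma row_mx_cons_rV a b (t : R) (x : 'rV[R]_a) (y : 'rV[R]_b) :
  row_mx (cons_rV (t, x)) y = cons_rV (t, row_mx x y) :> 'rV[R]_(a + b).+1.
Proof.
apply/rowP => i; case: (@split_ordP 1 (a + b) i) => j ->.
  rewrite (ord1 j) cons_rV0.
  transitivity ((row_mx (cons_rV (t, x)) y : 'rV[R]_(a.+1 + b)) ord0
      (lshift b (lshift a (ord0 : 'I_1) : 'I_(a.+1)))).
    by congr (_ _ _); exact: val_inj.
  by rewrite (@row_mxEl _ 1 a.+1 b) cons_rV0.
rewrite cons_rVS/=; case: (@split_ordP a b j) => k ->.
  rewrite row_mxEl.
  transitivity ((row_mx (cons_rV (t, x)) y : 'rV[R]_(a.+1 + b)) ord0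
      (lshift b (rshift 1 k : 'I_(a.+1)))).
    by congr (_ _ _); exact: val_inj.
  by rewrite (@row_mxEl _ 1 a.+1 b) cons_rVS.
rewrite row_mxEr.
transitivity ((row_mx (cons_rV (t, x)) y : 'rV[R]_(a.+1 + b)) ord0
    (rshift a.+1 k)).
  by congr (_ _ _); exact: val_inj.
by rewrite (@row_mxEr _ 1 a.+1 b).
Qed.

Lemma measurable_row_mx d (X : measurableType d) a b
    (f : X -> 'rV[R]_a) (g : X -> 'rV[R]_b) :
  measurable_fun setT f -> measurable_fun setT g ->
  measurable_fun setT (fun x => row_mx (f x) (g x)).
Proof.
move=> mf mg; apply: measurable_fun_rV => i; case: (split_ordP i) => k ->.
  by under eq_fun do rewrite row_mxEl; exact: measurable_rV_coord.
by under eq_fun do rewrite row_mxEr; exact: measurable_rV_coord.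
Qed.

Lemma ge0_integral_lebesgue_rV_row_mx a b (f : 'rV[R]_(a + b) -> \bar R) :
  measurable_fun setT f -> (forall x, 0 <= f x)%E ->
  (\int[lebesgue_rV (a + b)]_x f x =
   \int[lebesgue_rV a]_x \int[lebesgue_rV b]_y f (row_mx x y))%E.
Proof.
elim: a f => [|a IH] f mf f0.
  rewrite (@eq_measure_integral _ _ _ _ (dirac (0 : 'rV[R]_0)))//.
  rewrite integral_dirac//= ?diracT ?mul1e.
    by apply: eq_integral => y _; rewrite row_thin_mx.
  apply: (measurable_fun_fubini_tonelli_F (fun xy => f (row_mx xy.1 xy.2))) => //.
  by apply: (measurableT_comp mf); apply: measurable_row_mx.
have mfc t : measurable_fun setT (fun v : 'rV[R]_(a + b) => f (cons_rV (t, v))).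
  apply: (measurableT_comp mf).
  by apply: (measurableT_comp (@measurable_cons_rV R _)).
rewrite (ge0_integral_lebesgue_rV_cons mf f0).
have mG : measurable_fun setT (fun x : 'rV[R]_a.+1 =>
    \int[lebesgue_rV b]_y f (row_mx x y))%E.
  apply: (measurable_fun_fubini_tonelli_F (fun xy => f (row_mx xy.1 xy.2))) => //.
  by apply: (measurableT_comp mf); apply: measurable_row_mx.
rewrite (ge0_integral_lebesgue_rV_cons mG) => [|x]; last exact: integral_ge0.
apply: eq_integral => t _.
etransitivity; first exact: (IH _ (mfc t) (fun v => f0 _)).
apply: eq_integral => x _; apply: eq_integral => y _.
by rewrite row_mx_cons_rV.
Qed.

End split.

Section gauss.
Context {R : realType} (s : R) (s_gt0 : 0 < s).
Notation leb := (@lebesgue_measure R).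

Definition lgauss1 (t : R) : R := - (ln (2 * pi * s) / 2) - t ^+ 2 / (2 * s).

(** The logarithm of [gauss s]. In logarithmic form an additional independent Gaussian coordinate
    acts on the density by a translation. *)
Definition lgauss n (x : 'rV[R]_n) : R :=
  - (n%:R / 2 * ln (2 * pi * s)) - (\sum_(i < n) x ord0 i ^+ 2) / (2 * s).

Lemma l2norm_sqr n (x : 'rV[R]_n) : l2norm x ^+ 2 = \sum_(i < n) x ord0 i ^+ 2.
Proof. by rewrite sqr_sqrtr// sumr_ge0// => i _; rewrite sqr_ge0. Qed.

Lemma gaussE n (x : 'rV[R]_n) : gauss s x = expR (lgauss x).
Proof.
have p0 : 0 < 2 * pi * s by rewrite !mulr_gt0// pi_gt0.
by rewrite /gauss l2norm_sqr /powR gt_eqF// -expRD mulNr.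
Qed.

Lemma lgauss_cons n (t : R) (x : 'rV[R]_n) :
  lgauss (cons_rV (t, x)) = lgauss1 t + lgauss x.
Proof.
rewrite /lgauss /lgauss1 (@big_split_ord _ _ _ 1 n)/= big_ord1.
rewrite cons_rV0; under eq_bigr do rewrite cons_rVS.
by rewrite -[n.+1%:R]natr1/=; field; rewrite gt_eqF.
Qed.

Lemma lgauss_row_mx a b (x : 'rV[R]_a) (y : 'rV[R]_b) :
  lgauss (row_mx x y) = lgauss x + lgauss y.
Proof.
rewrite /lgauss big_split_ord/=.
under eq_bigr do rewrite row_mxEl.
under [X in - _ - (_ + X) / _]eq_bigr do rewrite row_mxEr.
by rewrite natrD; field; rewrite gt_eqF.
Qed.

Lemma measurable_lgauss n : measurable_fun setT (@lgauss n).
Proof.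
apply: measurable_funB => //; apply: measurable_funM => //.
apply: measurable_sum => i; apply: measurable_funX; exact: measurable_coord_rV.
Qed.

Lemma integral_lgauss1 : (\int[leb]_t (expR (lgauss1 t))%:E = 1)%E.
Proof.
have s0 : Num.sqrt s != 0 by rewrite gt_eqF// sqrtr_gt0.
rewrite -(integral_normal_pdf 0 (Num.sqrt s)); apply: eq_integral => t _.
rewrite /normal_pdf (negbTE s0) /normal_peak /normal_fun sqr_sqrtr ?ltW//.
have p0 : 0 < 2 * pi * s by rewrite !mulr_gt0// pi_gt0.
rewrite /lgauss1 expRD; congr (_ * _)%:E; last first.
  by rewrite subr0 mulNr -[s *+ 2]mulr_natl.
rewrite expRN; congr (_^-1).
rewrite (_ : s * pi *+ 2 = 2 * pi * s); last by ring.
apply: (@pexpIrn _ 2) => //; rewrite ?nnegrE ?expR_ge0 ?sqrtr_ge0//.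
by rewrite sqr_sqrtr ?ltW// -expRM_natl -mulrC divfK// lnK.
Qed.

Lemma integral_gauss n : (\int[lebesgue_rV n]_x (expR (lgauss x))%:E = 1)%E.
Proof.
elim: n => [|n IH].
  rewrite (@eq_measure_integral _ _ _ _ (dirac (0 : 'rV[R]_0)))//.
  rewrite integral_dirac//= ?diracT ?mul1e ?/lgauss ?big_ord0.
    by rewrite !mul0r oppr0 addr0 expR0.
  by apply/measurable_EFinP; apply: measurableT_comp => //; exact: measurable_lgauss.
rewrite ge0_integral_lebesgue_rV_cons//; last first.
  by apply/measurable_EFinP; apply: measurableT_comp => //; exact: measurable_lgauss.
under eq_integral => t _.
  under eq_integral => v _ do rewrite lgauss_cons expRD EFinM.
  rewrite ge0_integralZl//; last first.
    by apply/measurable_EFinP; apply: measurableT_comp => //; exact: measurable_lgauss.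
  rewrite IH mule1.
  over.
exact: integral_lgauss1.
Qed.

Lemma integrable_gauss n :
  (lebesgue_rV n).-integrable setT (fun x => (expR (lgauss x))%:E).
Proof.
apply/integrableP; split.
  by apply/measurable_EFinP; apply: measurableT_comp => //; exact: measurable_lgauss.
under eq_integral do rewrite gee0_abs ?lee_fin ?expR_ge0//.
by rewrite integral_gauss ltry.
Qed.

End gauss.

(** * Moving the atoms of a finite Gaussian mixture *)

Section is_derive1_lambda.
Context {R : realType}.
Implicit Types (f g : R -> R) (x a b k : R).

Lemma is_derive1D f g x a b : is_derive x 1 f a -> is_derive x 1 g b ->
  is_derive x 1 (fun t => f t + g t) (a + b).
Proof. by move=> fa gb; exact: is_deriveD. Qed.

Lemma is_derive1B f g x a b : is_derive x 1 f a -> is_derive x 1 g b ->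
  is_derive x 1 (fun t => f t - g t) (a - b).
Proof. by move=> fa gb; exact: is_deriveB. Qed.

Lemma is_derive1M f g x a b : is_derive x 1 f a -> is_derive x 1 g b ->
  is_derive x 1 (fun t => f t * g t) (f x * b + g x * a).
Proof. by move=> fa gb; exact: is_deriveM. Qed.

Lemma is_derive1Z f x a k : is_derive x 1 f a ->
  is_derive x 1 (fun t => k * f t) (k * a).
Proof. by move=> fa; exact: is_deriveZ. Qed.

Lemma is_derive1_cst x k : is_derive x 1 (fun=> k) 0.
Proof. exact: is_derive_cst. Qed.

Lemma is_derive1_compl f g x a b : is_derive (g x) 1 f a ->
  is_derive x 1 g b -> is_derive x 1 (fun t => f (g t)) (b * a).
Proof. by move=> fa gb; have := is_derive1_comp fa gb; rewrite mulrC. Qed.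

Lemma is_derive1_suml n (h : 'I_n -> R -> R) (dh : 'I_n -> R) x :
  (forall i, is_derive x 1 (h i) (dh i)) ->
  is_derive x 1 (fun t => \sum_i h i t) (\sum_i dh i).
Proof.
move=> hd; have := is_derive_sum hd.
by rewrite (_ : \sum_i h i = (fun t => \sum_i h i t))//; apply/funext => t; rewrite fct_sumE.
Qed.

Lemma is_derive1_continuous f x a : is_derive x 1 f a -> {for x, continuous f}.
Proof. by move=> [fd _]; apply: differentiable_continuous; exact/derivable1_diffP. Qed.

Lemma le0_is_derive_nincr f (df : R -> R) x y :
  x <= y -> (forall t : R, is_derive t 1 f (df t)) ->
  (forall t, x <= t <= y -> df t <= 0) -> f y <= f x.
Proof.
move=> xy fd df0.
have [|c] := MVT_segment xy (fun t _ => fd t).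
  by apply: continuous_subspaceT => t; exact: (is_derive1_continuous (fd t)).
rewrite in_itv/= => cxy /eqP; rewrite subr_eq => /eqP ->.
by rewrite gerDr mulr_le0_ge0 ?subr_ge0// df0.
Qed.

End is_derive1_lambda.

Section core.
Context {R : realType} (N m : nat) (s : R) (s_gt0 : 0 < s).
Variables (w : 'I_m -> R) (P Q : 'I_m -> 'rV[R]_N) (eta deta : R -> R) (B : R).
Hypothesis w_ge0 : forall i, 0 <= w i.
Hypothesis w_gt0 : 0 < \sum_i w i.
Hypothesis PQ_orth : forall i j,
  \sum_l (P i - P j) ord0 l * (Q i - Q j) ord0 l = 0.
Hypothesis QP_le : forall i j,
  \sum_l (Q i - Q j) ord0 l ^+ 2 <= \sum_l (P i - P j) ord0 l ^+ 2.
Hypothesis eta_is_derive : forall t : R, is_derive t 1 eta (deta t).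
Hypothesis deta_cont : continuous deta.
Hypothesis eta_bnd : forall t : R, `|eta t| <= B.
Hypothesis deta_bnd : forall t : R, - B <= deta t <= 0.

Definition mixture (X : 'I_m -> 'rV[R]_N) (x : 'rV[R]_N) : R :=
  \sum_j w j * expR (lgauss s (x - X j)).

Let X (th : R) (i : 'I_m) : 'rV[R]_N := cos th *: P i + sin th *: Q i.
Let V (th : R) (i : 'I_m) : 'rV[R]_N := (- sin th) *: P i + cos th *: Q i.
(** The derivative in [th] of [lgauss s (z + X th i - X th j)] at fixed z, expressed at x = z + X th
    i; [V] is the velocity of [X]. *)
Let D i j th (x : 'rV[R]_N) : R :=
  - ((\sum_l (x - X th j) ord0 l * (V th i - V th j) ord0 l) / s).

Lemma mixture_gt0 Y x : 0 < mixture Y x.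
Proof.
have [i wi] : exists i, 0 < w i.
  apply/existsP; rewrite -[X in is_true X]negbK negb_exists; apply/negP => /forallP h.
  move: w_gt0; rewrite big1 ?ltxx// => i _.
  by apply/eqP; rewrite eq_le w_ge0 andbT leNgt h.
rewrite /mixture (bigD1 i)//= ltr_wpDr ?mulr_gt0 ?expR_gt0//.
by rewrite sumr_ge0// => j _; rewrite mulr_ge0 ?expR_ge0.
Qed.

(** Seen from the moving atom i, the weight [expR (lgauss s z)] is free of [th]: the derivative
    falls on [eta (ln u)] alone, and one dominating function serves all [th]. *)
Let u i th (z : 'rV[R]_N) := mixture (X th) (z + X th i).

Let lgauss_deriv i j (z : 'rV[R]_N) (th : R) :
  is_derive th 1 (fun th => lgauss s (z + X th i - X th j)) (D i j th (z + X th i)).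
Proof.
pose h (l : 'I_N) (t : R) := z ord0 l + (cos t * (P i - P j) ord0 l + sin t * (Q i - Q j) ord0 l).
have hE l t : (z + X t i - X t j) ord0 l = h l t.
  by rewrite /h /X !mxE; ring.
have hd l : is_derive th 1 (h l) ((V th i - V th j) ord0 l).
  apply: (is_derive_eq (is_derive1D (is_derive1_cst th _)
    (is_derive1D (is_derive1M (is_derive_cos th) (is_derive1_cst th _))
                 (is_derive1M (is_derive_sin th) (is_derive1_cst th _))))).
  by rewrite /V !mxE; ring.
rewrite (_ : (fun _ => _) = (fun t =>
   - (N%:R / 2 * ln (2 * pi * s)) - (2 * s)^-1 * \sum_l (h l t * h l t))); last first.
  apply/funext => t; rewrite /lgauss; congr (_ - _); rewrite mulrC; congr (_ * _).
  by apply: eq_bigr => l _; rewrite hE expr2.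
apply: (is_derive_eq (is_derive1B (is_derive1_cst th _)
  (is_derive1Z _ (is_derive1_suml (fun l => is_derive1M (hd l) (hd l)))))).
rewrite sub0r /D; congr (- _).
under eq_bigr do rewrite -mulr2n -mulr_natl.
rewrite -mulr_sumr mulrA [RHS]mulrC; congr (_ * _).
  by rewrite invfM mulrC mulrA divff ?mul1r.
by apply: eq_bigr => l _; rewrite hE.
Qed.

Let du i (th : R) (z : 'rV[R]_N) := \sum_j w j *
  (expR (lgauss s (z + X th i - X th j)) * D i j th (z + X th i)).

Let u_deriv i z (th : R) : is_derive th 1 (fun th => u i th z) (du i th z).
Proof.
apply: is_derive1_suml => j; apply: is_derive1Z.
have := is_derive1_compl (is_derive_expR _) (lgauss_deriv i j z th).
by rewrite mulrC.
Qed.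

Let f i (th : R) (z : 'rV[R]_N) := expR (lgauss s z) * eta (ln (u i th z)).
Let df i (th : R) (z : 'rV[R]_N) := expR (lgauss s z) *
  (du i th z * (u i th z)^-1 * deta (ln (u i th z))).

Let f_deriv i z (th : R) : is_derive th 1 (fun th => f i th z) (df i th z).
Proof.
apply: is_derive1Z; apply: (is_derive1_compl (eta_is_derive _)).
exact: (is_derive1_compl (is_derive1_ln (mixture_gt0 _ _)) (u_deriv i z th)).
Qed.

(* Exchanging i and j replaces x - x_j by x_i - x_j, up to a factor 1/2. *)
Let sym th (x : 'rV[R]_N) : 0 <= th <= pi / 2 ->
  0 <= \sum_i \sum_j w i * w j * (expR (lgauss s (x - X th i)) *
         expR (lgauss s (x - X th j))) * D i j th x.
Proof.
move=> /andP[th0 th2].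
pose a i j := w i * w j * (expR (lgauss s (x - X th i)) * expR (lgauss s (x - X th j))).
suff h i j : 0 <= a i j * D i j th x + a j i * D j i th x.
  rewrite -(@pmulrn_lge0 _ _ 2)// mulr2n [X in _ + X]exchange_big/= -big_split/=.
  by apply: sumr_ge0 => i _; rewrite -big_split/=; apply: sumr_ge0 => j _; exact: h.
have -> : a j i = a i j by rewrite /a [w j * _]mulrC [X in _ * X = _]mulrC.
rewrite -mulrDr mulr_ge0//.
  by rewrite /a mulr_ge0 ?mulr_ge0 ?expR_ge0.
rewrite /D -opprD -mulrDl -big_split/= -mulNr mulr_ge0 ?invr_ge0 ?(ltW s_gt0)//.
rewrite oppr_ge0.
pose p l := (P i - P j) ord0 l; pose q l := (Q i - Q j) ord0 l.
(* The sum is <X_i - X_j, V_i - V_j> = cos sin (|q|^2 - |p|^2) + (cos^2 - sin^2) <p, q>.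
   Orthogonality removes the last term; cos and sin are nonnegative on [0, pi/2]. *)
rewrite (eq_bigr (fun l => (cos th * sin th) * (q l ^+ 2) - (cos th * sin th) * (p l ^+ 2)
   + (cos th ^+ 2 - sin th ^+ 2) * (p l * q l))); last first.
  by move=> l _; rewrite /p /q /X /V !mxE; ring.
rewrite big_split/= -mulr_sumr PQ_orth mulr0 addr0 sumrB -!mulr_sumr -mulrBr.
rewrite mulr_ge0_le0 ?subr_le0 ?QP_le// mulr_ge0//.
  by rewrite cos_ge0_pihalf// th2 andbT (le_trans _ th0)// oppr_le0 divr_ge0 ?pi_ge0.
rewrite sin_ge0_pi// th0 (le_trans th2)// ler_pdivrMr// ler_peMr ?pi_ge0//.
by rewrite ler1n.
Qed.

Let K : R := \sum_i \sum_l (`|P i ord0 l| + `|Q i ord0 l|).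

Let PQK i l : `|P i ord0 l| + `|Q i ord0 l| <= K.
Proof.
rewrite /K (bigD1 i)//= (bigD1 l)//= -addrA lerDl addr_ge0//; apply: sumr_ge0 => // k _.
by apply: sumr_ge0 => ? _.
Qed.

Let K_ge0 : 0 <= K.
Proof. by do 2 (apply: sumr_ge0 => ? _); rewrite addr_ge0. Qed.

Let XK th i l : `|X th i ord0 l| <= K.
Proof.
apply: le_trans (PQK i l); rewrite /X !mxE (le_trans (ler_normD _ _))// !normrM.
by rewrite lerD// ler_piMl// ?ler_norml ?cos_geN1 ?cos_le1 ?sin_geN1 ?sin_le1.
Qed.

Let VK th i l : `|V th i ord0 l| <= K.
Proof.
apply: le_trans (PQK i l); rewrite /V !mxE (le_trans (ler_normD _ _))// !normrM normrN.
by rewrite lerD// ler_piMl// ?ler_norml ?cos_geN1 ?cos_le1 ?sin_geN1 ?sin_le1.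
Qed.

(* |z| exp(-|z|^2/2s) is dominated by a Gaussian of variance 2s, through
   1 + r <= exp r for r = |z|^2/4s. *)
Let A : R := N%:R * (1 + 2 * K + 4 * s) * (2 * K) / s.

Let DA i j th z :
  `|D i j th (z + X th i)| <= A * expR ((\sum_l z ord0 l ^+ 2) / (4 * s)).
Proof.
set q := \sum_l _ ^+ 2.
have q0 : 0 <= q by apply: sumr_ge0 => l _; rewrite sqr_ge0.
have zq l : `|z ord0 l| <= 1 + q.
  have : `|z ord0 l| ^+ 2 <= q.
    rewrite -normrX ger0_norm ?sqr_ge0// /q (bigD1 l)//= lerDl.
    by apply: sumr_ge0 => ? _; rewrite sqr_ge0.
  by have := sqr_ge0 (`|z ord0 l| - 1); rewrite sqrrB1; lra.
rewrite /D normrN normrM normfV (gtr0_norm s_gt0).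
have -> : A * expR (q / (4 * s)) =
    N%:R * (expR (q / (4 * s)) * (1 + 2 * K + 4 * s) * (2 * K)) / s.
  by rewrite /A; ring.
rewrite ler_pM2r ?invr_gt0//.
apply: (le_trans (ler_norm_sum _ _ _)).
rewrite -[N in leRHS]card_ord -sum1_card natr_sum mulr_suml ler_sum// => l _.
rewrite mul1r normrM ler_pM//; last first.
  rewrite !mxE (le_trans (ler_normB _ _))//.
  by have := VK th i l; have := VK th j l; rewrite !mxE; lra.
have e1 := expR_ge1Dx (q / (4 * s)).
rewrite 2!mxE [X in `|_ + X|]mxE.
apply: (@le_trans _ _ (1 + q + 2 * K)).
  rewrite (le_trans (ler_normB _ _))//.
  have := ler_normD (z ord0 l) (X th i ord0 l).
  by have := XK th i l; have := XK th j l; have := zq l; lra.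
have s4 : 0 < 4 * s by rewrite mulr_gt0.
have e2 : q = (q / (4 * s)) * (4 * s) by rewrite divfK// gt_eqF.
rewrite {1}e2; set r := q / _ in e1 *.
have r0 : 0 <= r by rewrite divr_ge0// ltW.
apply: (@le_trans _ _ ((1 + r) * (1 + 2 * K + 4 * s))); last first.
  by rewrite ler_wpM2r// !addr_ge0// ?mulr_ge0// ltW.
have rK : 0 <= r * K by rewrite mulr_ge0.
have : 0 <= s by rewrite ltW.
nra.
Qed.

(** The bound on [D] does not depend on j, so it factors out of the weighted sum: du/u is controlled
    without any lower bound on u. *)
Let duA i th z :
  `|du i th z| <= A * expR ((\sum_l z ord0 l ^+ 2) / (4 * s)) * u i th z.
Proof.
apply: (le_trans (ler_norm_sum _ _ _)).
rewrite /u /mixture mulr_sumr ler_sum// => j _.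
rewrite normrM (ger0_norm (w_ge0 j)) mulrCA ler_wpM2l//.
by rewrite normrM (ger0_norm (expR_ge0 _)) mulrC ler_wpM2r ?expR_ge0.
Qed.

Let G (z : 'rV[R]_N) : R :=
  B * A * expR (lgauss s z + (\sum_l z ord0 l ^+ 2) / (4 * s)).

Let B_ge0 : 0 <= B.
Proof. by apply: le_trans (eta_bnd 0). Qed.

Let dfG i th z : `|df i th z| <= G z.
Proof.
rewrite /df /G expRD normrM (ger0_norm (expR_ge0 _)).
rewrite [leRHS]mulrCA ler_wpM2l ?expR_ge0//.
have u0 := mixture_gt0 (X th) (z + X th i); rewrite -/(u i th z) in u0.
rewrite -[leRHS]mulrA [leRHS]mulrC normrM ler_pM//.
  by rewrite normrM normfV (gtr0_norm u0) ler_pdivrMr.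
by have := deta_bnd (ln (u i th z)); rewrite ler_norml => /andP[-> /le_trans ->].
Qed.

Let mlg (a : 'rV[R]_N) : measurable_fun setT (fun z : 'rV[R]_N => expR (lgauss s (z + a))).
Proof.
apply: measurableT_comp => //; apply: (measurableT_comp (@measurable_lgauss R s N)).
exact: measurable_rVD.
Qed.

Let mu_ th i : measurable_fun setT (u i th).
Proof.
apply: measurable_sum => j; apply: measurable_funM => //.
by under eq_fun do rewrite -addrA; exact: mlg.
Qed.

Let mD i j th : measurable_fun setT (fun z : 'rV[R]_N => D i j th (z + X th i)).
Proof.
rewrite /D; apply: measurable_funN; apply: measurable_funM => //.
apply: measurable_sum => l; apply: measurable_funM => //.
apply: measurable_rV_coord; apply: measurable_rVB => //; exact: measurable_rVD.
Qed.

Let mlnu th i : measurable_fun setT (fun z => ln (u i th z)).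
Proof. exact: measurableT_comp. Qed.

Let eta_cont : continuous eta.
Proof. by move=> t; exact: (is_derive1_continuous (eta_is_derive t)). Qed.

Let mg : measurable_fun setT (fun z : 'rV[R]_N => expR (lgauss s z)).
Proof. by apply: measurableT_comp => //; exact: measurable_lgauss. Qed.

Let mf th i : measurable_fun setT (f i th).
Proof.
apply: measurable_funM => //.
by apply: (measurableT_comp (continuous_measurable_fun eta_cont)).
Qed.

Let mdf th i : measurable_fun setT (df i th).
Proof.
apply: measurable_funM => //; apply: measurable_funM; last first.
  by apply: (measurableT_comp (continuous_measurable_fun deta_cont)).
apply: measurable_funM.
  apply: measurable_sum => j; apply: measurable_funM => //.
  by apply: measurable_funM => //; under eq_fun do rewrite -addrA; exact: mlg.
(* Positivity of u lets its inverse be measured through [ln] and [expR]. *)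
rewrite (_ : (fun _ => _) = (fun z => expR (- ln (u i th z)))).
  by apply: measurableT_comp => //; exact: measurableT_comp.
by apply/funext => z; rewrite expRN lnK//; exact: mixture_gt0.
Qed.

Let fi th i : (lebesgue_rV N).-integrable setT (EFin \o f i th).
Proof.
apply: (@le_integrable _ _ _ _ _ _ _ (fun z => (B * expR (lgauss s z))%:E)) => //.
- exact/measurable_EFinP.
- move=> z _ /=; rewrite lee_fin /f normrM (ger0_norm (expR_ge0 _)).
  by rewrite [leRHS]ger0_norm ?mulr_ge0 ?expR_ge0// mulrC ler_wpM2r ?expR_ge0.
- by under eq_fun do rewrite EFinM; apply: integrableZl => //; exact: integrable_gauss.
Qed.

Let Gi : (lebesgue_rV N).-integrable setT (EFin \o G).
Proof.
have s2 : 0 < 2 * s by rewrite mulr_gt0.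
(* The logarithm of the ratio of the normalising constants for variances s and 2s. *)
pose c : R := N%:R / 2 * ln (2 * pi * (2 * s)) - N%:R / 2 * ln (2 * pi * s).
rewrite (_ : _ \o _ = (fun z => (B * A * expR c)%:E * (expR (lgauss (2 * s) z))%:E)%E).
  by apply: integrableZl => //; exact: integrable_gauss.
apply/funext => z /=; rewrite -EFinM; congr EFin.
rewrite /G -[RHS]mulrA -expRD; congr (_ * expR _).
by rewrite /lgauss /c; field; rewrite gt_eqF.
Qed.

Let dfi th i : (lebesgue_rV N).-integrable setT (EFin \o df i th).
Proof.
apply: (@le_integrable _ _ _ _ _ _ _ (EFin \o G)) => //.
- exact/measurable_EFinP.
- move=> z _ /=; rewrite lee_fin; apply: le_trans (dfG i th z) _; exact: ler_norm.
Qed.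

Let G_ge0 z : 0 <= G z.
Proof.
rewrite /G !mulr_ge0 ?expR_ge0// ?invr_ge0 ?(ltW s_gt0)//.
by rewrite !addr_ge0 ?mulr_ge0 ?(ltW s_gt0).
Qed.

Let M i th := (\int[lebesgue_rV N]_z f i th z)%R.

Let M_deriv i (th : R) : is_derive th 1 (M i) (\int[lebesgue_rV N]_z df i th z)%R.
Proof.
have Ith : (`]th - 1, th + 1[%classic : set R) th.
  by rewrite /= in_itv/= ltrBlDr !ltrDl ltr01.
have pE x y : partial1of2 (f i) x y = df i x y.
  by rewrite partial1of2E; have [] := f_deriv i y x.
have df1 x y : (`]th - 1, th + 1[%classic : set R) x -> setT y ->
    derivable (f i ^~ y) x 1 by move=> _ _; have [] := f_deriv i y x.
have dF := @derivable_under_integral _ _ _ _ (f i) _ measurableT _ _ _ Ith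
  (fun x _ => fi x i) df1 _ G_ge0 Gi.
have DF := @differentiation_under_integral _ _ _ _ (f i) _ measurableT _ _ _ Ith
  (fun x _ => fi x i) df1 _ G_ge0 Gi.
have Gub : forall x y, (`]th - 1, th + 1[%classic : set R) x -> setT y ->
    `|partial1of2 (f i) x y| <= G y by move=> x y _ _; rewrite pE.
apply: DeriveDef; first exact: (dF Gub).
rewrite -derive1E (DF Gub); apply: eq_Rintegral => y _; exact: pE.
Qed.

Let dM_le0 th : 0 <= th <= pi / 2 ->
  \sum_i w i * (\int[lebesgue_rV N]_z df i th z)%R <= 0.
Proof.
move=> thI.
pose g i (x : 'rV[R]_N) := df i th (x - X th i).
have gi i : (lebesgue_rV N).-integrable setT (fun x => (g i x)%:E).
  exact: (integrable_lebesgue_rV_translate (- X th i) (dfi th i)).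
have gE i : (\int[lebesgue_rV N]_z df i th z = \int[lebesgue_rV N]_z g i z)%R.
  exact: (esym (integral_lebesgue_rV_translate (- X th i) (dfi th i))).
under eq_bigr do rewrite gE.
have wgi i : (lebesgue_rV N).-integrable setT (fun x => (w i * g i x)%:E).
  by under eq_fun do rewrite EFinM; apply: integrableZl => //; exact: gi.
rewrite -lee_fin -sumEFin.
rewrite (eq_bigr (fun i => \int[lebesgue_rV N]_x (w i * g i x)%:E)%E); last first.
  move=> i _; under [RHS]eq_integral do rewrite EFinM.
  rewrite integralZl// EFinM /Rintegral fineK//; exact: integrable_fin_num.
rewrite -integral_sum//.
rewrite -[leRHS](integral0 (lebesgue_rV N) setT).
apply: le_integral => //; [exact: integrable_sum|exact: integrable0|].
move=> x _; rewrite sumEFin lee_fin.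
pose rho := mixture (X th) x.
have rho_gt0 : 0 < rho by exact: mixture_gt0.
(* Once translated back to the common point x, all summands share the factor [deta (ln rho) / rho]
   <= 0, and what remains is the double sum of [sym]. *)
have {}gE i : g i x = (deta (ln rho) / rho) * \sum_j w j *
   ((expR (lgauss s (x - X th i)) * expR (lgauss s (x - X th j))) * D i j th x).
  rewrite /g /df /u /du !subrK.
  have E (a S r d : R) : a * (S / r * d) = d / r * (a * S).
    by ring.
  rewrite E; congr (_ * _); rewrite mulr_sumr; apply: eq_bigr => j _.
  by rewrite mulrCA -[in RHS]mulrA.
under eq_bigr do rewrite gE mulrCA.
rewrite -mulr_sumr mulr_le0_ge0//.
  by rewrite mulr_le0_ge0 ?invr_ge0 ?(ltW rho_gt0)//; have /andP[] := deta_bnd (ln rho).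
apply: le_trans (sym x thI) _; rewrite le_eqVlt; apply/orP; left; apply/eqP.
apply: eq_bigr => i _; rewrite mulr_sumr; apply: eq_bigr => j _.
by rewrite -!mulrA.
Qed.

Theorem mixture_contraction :
  \sum_i w i * (\int[lebesgue_rV N]_z
     (expR (lgauss s z) * eta (ln (mixture Q (z + Q i)))))%R <=
  \sum_i w i * (\int[lebesgue_rV N]_z
     (expR (lgauss s z) * eta (ln (mixture P (z + P i)))))%R.
Proof.
have X0 : X 0 = P by apply/funext => i; rewrite /X cos0 sin0 scale1r scale0r addr0.
have X1 : X (pi / 2) = Q.
  by apply/funext => i; rewrite /X cos_pihalf sin_pihalf scale1r scale0r add0r.
have pi2 : 0 <= pi / 2 :> R by rewrite divr_ge0 ?pi_ge0.
have := @le0_is_derive_nincr _ (fun th => \sum_i w i * M i th) _ _ _ pi2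
  (fun t => is_derive1_suml (fun i => is_derive1Z (w i) (M_deriv i t)))
  (fun t => @dM_le0 t).
by rewrite /M /f /u X0 X1.
Qed.

End core.

(** * From finite mixtures to arbitrary measures *)

Section dct.
Local Open Scope ereal_scope.
Context d (T : measurableType d) (R : realType) (mu : {measure set T -> \bar R}).
Variables (f_ : nat -> T -> R) (f g : T -> R).
Hypothesis mf_ : forall n, measurable_fun setT (f_ n).
Hypothesis f_f : forall x, f_ n x @[n --> \oo] --> f x.
Hypothesis f_g : forall n x, (`|f_ n x| <= g x)%R.
Hypothesis ig : mu.-integrable setT (EFin \o g).

Lemma cvg_integral_dominated :
  \int[mu]_x (f_ n x)%:E @[n --> \oo] --> \int[mu]_x (f x)%:E.
Proof.
have mf : measurable_fun setT f.
  by apply: (measurable_fun_cvg mf_) => x _; exact: f_f.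
have [] := @dominated_convergence _ _ _ mu setT measurableT
  (fun n x => (f_ n x)%:E) (EFin \o f) (EFin \o g) => //.
- by move=> n; exact/measurable_EFinP.
- exact/measurable_EFinP.
- by apply: aeW => x _; apply: cvg_EFin; [exact: nearW|exact: f_f].
- by apply: aeW => x n _; rewrite /= lee_fin.
Qed.

End dct.

Section nearest_rational.
Context {R : realType} (n : nat).

Definition rat_rV (j : nat) : 'rV[R]_n :=
  if unpickle j is Some q then map_mx ratr (q : 'rV[rat]_n) else 0.

Definition dist1 (x y : 'rV[R]_n) : R := \sum_l `|x ord0 l - y ord0 l|.

(** A measurable choice of a closest point among the first m + 1 of an enumeration of the rational
    vectors; on ties the earlier index stays. Replacing y by this point makes mu finitely supported
    and converges to y pointwise. *)
Fixpoint nearest (m : nat) (y : 'rV[R]_n) : nat :=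
  if m is m'.+1 then
    if dist1 y (rat_rV m) < dist1 y (rat_rV (nearest m' y)) then m
    else nearest m' y
  else 0%N.

Lemma nearest_le m y : (nearest m y <= m)%N.
Proof. by elim: m => //= m IH; case: ifP => // _; exact: leqW. Qed.

Lemma nearest_min m y j : (j <= m)%N ->
  dist1 y (rat_rV (nearest m y)) <= dist1 y (rat_rV j).
Proof.
elim: m => [|m IH]; first by rewrite leqn0 => /eqP ->.
rewrite leq_eqVlt ltnS => /predU1P[->|/IH h] /=.
  case: ifPn => [_|]; [exact: lexx|by rewrite -leNgt].
by case: ifPn => [/ltW/le_trans|_]; [apply; exact: h|exact: h].
Qed.

Lemma measurable_dist1 c : measurable_fun setT (dist1 ^~ c).
Proof.
apply: measurable_sum => l; apply: measurableT_comp => //.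
by apply: measurable_funB => //; exact: measurable_coord_rV.
Qed.

Lemma measurable_nearest m j : measurable [set y | nearest m y = j].
Proof.
elim: m j => [|m IH] j.
  have [->|j0] := eqVneq j 0%N.
    by rewrite (_ : [set _ | _] = setT)//; apply/seteqP; split.
  rewrite (_ : [set _ | _] = set0)//; apply/seteqP; split => // y /= E.
  by rewrite -E eqxx in j0.
pose b i (y : 'rV[R]_n) := dist1 y (rat_rV m.+1) < dist1 y (rat_rV i).
have mb i : measurable_fun setT (b i).
  by apply: measurable_fun_ltr; exact: measurable_dist1.
rewrite (_ : [set _ | _] = \bigcup_i ([set y | nearest m y = i] `&`
    ((fun y => if b i y then m.+1 else i) @^-1` [set j]))); last first.
  by apply/seteqP; split => [y /= <-|y [i _ [/= <- <-]]]//; exists (nearest m y).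
apply: bigcupT_measurable => i; apply: measurableI => //.
rewrite -[X in measurable X]setTI.
by apply: measurable_fun_ifT.
Qed.

Lemma nearest_cvg y l : rat_rV (nearest m y) ord0 l @[m --> \oo] --> y ord0 l.
Proof.
apply/cvgrPdist_lt => e e0.
(* The n coordinate errors must add up to less than e; [n.+1] also covers n = 0. *)
have e1 : 0 < e / n.+1%:R by rewrite divr_gt0.
have H k : exists q : rat, `|y ord0 k - ratr q| < e / n.+1%:R.
  have [q] := @rat_in_itvoo R (y ord0 k - e / n.+1%:R) (y ord0 k + e / n.+1%:R)
    (ltac:(by rewrite ltrBlDr -addrA ltrDl addr_gt0)).
  by rewrite in_itv/= => qe; exists q; rewrite distrC ltr_distl.
have [q Hq] := choice H.
near=> m.
have jm : (pickle (\row_k q k : 'rV[rat]_n) <= m)%N by near: m; exact: nbhs_infty_ge.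
apply: le_lt_trans (_ : dist1 y (rat_rV (nearest m y)) < e).
  by rewrite /dist1 (bigD1 l)//= lerDl sumr_ge0.
apply: le_lt_trans (nearest_min y jm) _.
rewrite /dist1 /rat_rV pickleK.
apply: (@le_lt_trans _ _ (\sum_(k < n) e / n.+1%:R)).
  by apply: ler_sum => k _; rewrite !mxE ltW.
rewrite sumr_const card_ord -[ltLHS]mulr_natl mulrCA gtr_pMr// ltr_pdivrMr// mul1r.
by rewrite ltr_nat.
Unshelve. all: by end_near. Qed.

Variable mu : probability 'rV[R]_n R.

Definition nearest_weight m (j : 'I_m.+1) : R :=
  fine (mu [set y | nearest m y = j]).

Lemma nearest_weight_ge0 m j : 0 <= @nearest_weight m j.
Proof. exact: fine_ge0. Qed.

Lemma ge0_integral_nearest m (h : nat -> R) : (forall j, 0 <= h j) ->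
  (\int[mu]_y (h (nearest m y))%:E = (\sum_(j < m.+1) nearest_weight j * h j)%:E)%E.
Proof.
move=> h0.
pose A (j : nat) := [set y | nearest m y = j].
have mA j : measurable (A j) by exact: measurable_nearest.
rewrite (eq_integral (fun y => (\sum_(j < m.+1) (h j * \1_(A j) y)%:E)%E)); last first.
  move=> y _; rewrite (bigD1 (inord (nearest m y) : 'I_m.+1))//= inordK ?ltnS ?nearest_le//.
  rewrite indicE mem_set//= mulr1 big1 ?adde0// => j jy.
  rewrite indicE memNset/= ?mulr0// /A/= => E; move/eqP : jy; apply.
  by apply: val_inj => /=; rewrite inordK ?ltnS ?nearest_le.
rewrite ge0_integral_sum//; last 2 first.
- by move=> j; apply/measurable_EFinP/measurable_funM => //; exact: measurable_indic.
- by move=> j y Dy; rewrite lee_fin mulr_ge0.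
rewrite -sumEFin; apply: eq_bigr => j _.
under eq_integral do rewrite EFinM.
rewrite ge0_integralZl//; last 2 first.
- by apply/measurable_EFinP; exact: measurable_indic.
- by rewrite lee_fin.
rewrite integral_indic// setIT muleC EFinM /nearest_weight fineK//.
by apply: fin_num_measure; exact: mA.
Qed.

Lemma nearest_weight_sum m : \sum_(j < m.+1) nearest_weight j = 1.
Proof.
have := @ge0_integral_nearest m (fun=> 1) (fun=> ler01).
rewrite integral_cst//= probability_setT mul1e => -[->].
by apply: eq_bigr => j _; rewrite mulr1.
Qed.

End nearest_rational.

Section density.
Context {R : realType} (s : R) (s_gt0 : 0 < s) d (Y : measurableType d).
Variable (mu : probability Y R) (N : nat).
Implicit Types X : Y -> 'rV[R]_N.

(** The density of the law of X under mu, convolved with the Gaussian. Keeping mu fixed and varying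
    X couples the atoms of two such densities: those at X y and Y y have the same weight. *)
Definition density X (x : 'rV[R]_N) : R :=
  fine (\int[mu]_y (expR (lgauss s (x - X y)))%:E).

Lemma lgauss_le0 (x : 'rV[R]_N) : lgauss s x <= lgauss s (0 : 'rV[R]_N).
Proof.
rewrite /lgauss lerD2l lerN2 big1 => [|i _]; last by rewrite mxE expr0n.
by rewrite mul0r divr_ge0 ?mulr_ge0 ?(ltW s_gt0)// sumr_ge0// => i _; exact: sqr_ge0.
Qed.

Lemma measurable_gauss : measurable_fun setT (fun x : 'rV[R]_N => expR (lgauss s x)).
Proof. by apply: measurableT_comp => //; exact: measurable_lgauss. Qed.

Lemma measurable_gauss_sub X : measurable_fun setT X ->
  measurable_fun setT (fun xy : 'rV[R]_N * Y => expR (lgauss s (xy.1 - X xy.2))).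
Proof.
move=> mX; apply: (measurableT_comp measurable_gauss).
by apply: measurable_rVB => //; exact: measurableT_comp.
Qed.

Lemma measurable_gauss_subr X x : measurable_fun setT X ->
  measurable_fun setT (fun y : Y => expR (lgauss s (x - X y))).
Proof.
move=> mX; apply: (measurableT_comp measurable_gauss).
exact: measurable_rVB.
Qed.

Section measurable_X.
Variables (X : Y -> 'rV[R]_N) (mX : measurable_fun setT X).

Lemma integrable_gauss_subr x :
  mu.-integrable setT (fun y => (expR (lgauss s (x - X y)))%:E).
Proof.
apply: (@le_integrable _ _ _ _ _ _ _ (EFin \o cst (expR (lgauss s (0 : 'rV[R]_N))))) => //.
- by apply/measurable_EFinP; exact: measurable_gauss_subr.
- by move=> y _; rewrite /= lee_fin !ger0_norm ?expR_ge0// ler_expR lgauss_le0.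
- exact: finite_measure_integrable_cst.
Qed.

Lemma densityE x :
  (\int[mu]_y (expR (lgauss s (x - X y)))%:E = (density X x)%:E)%E.
Proof.
rewrite /density fineK//; apply: integrable_fin_num => //.
exact: integrable_gauss_subr.
Qed.

Lemma density_le x : density X x <= expR (lgauss s (0 : 'rV[R]_N)).
Proof.
rewrite -lee_fin -densityE; set c := expR _.
have <- : (\int[mu]_y (c%:E) = c%:E)%E.
  by rewrite integral_cst//= probability_setT mule1.
apply: ge0_le_integral => //.
- by apply/measurable_EFinP; exact: measurable_gauss_subr.
- by move=> y Dy; rewrite lee_fin ler_expR lgauss_le0.
Qed.

(** A vanishing integral would force the integrand, which is positive everywhere, to be zero almost
    everywhere; the whole space would then be a null set of a probability. *)
Lemma density_gt0 x : 0 < density X x.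
Proof.
rewrite lt_neqAle; apply/andP; split; last first.
  by rewrite fine_ge0// integral_ge0// => y _; rewrite lee_fin expR_ge0.
apply/eqP => d0.
have : (\int[mu]_y `|(expR (lgauss s (x - X y)))%:E| = 0)%E.
  under eq_integral do rewrite gee0_abs ?lee_fin ?expR_ge0//.
  by rewrite densityE -d0.
have mE : measurable_fun setT (fun y => (expR (lgauss s (x - X y)))%:E).
  by apply/measurable_EFinP; exact: measurable_gauss_subr.
move/(ae_eq_integral_abs _ measurableT mE).1 => [A [mA A0 sub]].
have AT : A = setT.
  apply/seteqP; split => // y _; apply: sub => /= /(_ I)[].
  by apply/eqP; rewrite gt_eqF ?expR_gt0.
by have := @probability_setT _ _ _ mu; rewrite -AT A0 => -[] /esym/eqP; rewrite oner_eq0.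
Qed.

Lemma measurable_density : measurable_fun setT (density X).
Proof.
apply/measurable_EFinP.
rewrite (_ : _ \o _ = fun x => \int[mu]_y (expR (lgauss s (x - X y)))%:E)%E.
  apply: (measurable_fun_fubini_tonelli_F
    (fun xy : 'rV[R]_N * Y => (expR (lgauss s (xy.1 - X xy.2)))%:E)) => //.
  by apply/measurable_EFinP; exact: measurable_gauss_sub.
by apply/funext => x; rewrite densityE.
Qed.

(** Tonelli, then the translation x = z + X y for each y: the integral becomes a mu-average of
    Gaussian means centred at the atoms, as in the finite case. *)
Lemma integral_density_mul (g : 'rV[R]_N -> R) :
  measurable_fun setT g -> (forall x, 0 <= g x) ->
  (\int[lebesgue_rV N]_x (density X x * g x)%:E =
   \int[mu]_y \int[lebesgue_rV N]_z (expR (lgauss s z) * g (z + X y))%:E)%E.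
Proof.
move=> mg g0.
transitivity (\int[lebesgue_rV N]_x \int[mu]_y (expR (lgauss s (x - X y)) * g x)%:E)%E.
  apply: eq_integral => x _; rewrite EFinM -densityE -ge0_integralZr//.
  - by apply/measurable_EFinP; exact: measurable_gauss_subr.
  - by rewrite lee_fin.
rewrite (fubini_tonelli (fun xy : 'rV[R]_N * Y =>
    (expR (lgauss s (xy.1 - X xy.2)) * g xy.1)%:E)); last 2 first.
- apply/measurable_EFinP; apply: measurable_funM; first exact: measurable_gauss_sub.
  exact: measurableT_comp.
- by move=> xy; rewrite lee_fin mulr_ge0// expR_ge0.
apply: eq_integral => y _ /=.
have mf : measurable_fun setT (fun x : 'rV[R]_N => (expR (lgauss s (x - X y)) * g x)%:E).
  apply/measurable_EFinP; apply: measurable_funM => //.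
  by apply: (measurableT_comp measurable_gauss); exact: measurable_rVB.
have f0 (x : 'rV[R]_N) : (0 <= (expR (lgauss s (x - X y)) * g x)%:E)%E.
  by rewrite lee_fin mulr_ge0// expR_ge0.
rewrite -(@ge0_integral_lebesgue_rV_translate _ _ (X y) _ mf f0).
by apply: eq_integral => z _; rewrite addrK.
Qed.

Lemma integral_density : (\int[lebesgue_rV N]_x (density X x)%:E = 1)%E.
Proof.
have := @integral_density_mul (cst 1) (measurable_cst _) (fun=> ler01).
under eq_integral do rewrite mulr1.
move=> ->.
under eq_integral => y _.
  under eq_integral do rewrite mulr1.
  rewrite integral_gauss//; over.
by rewrite integral_cst// mul1e; exact: probability_setT.
Qed.

End measurable_X.

End density.

Section discretization.
Context {R : realType} (s : R) (s_gt0 : 0 < s) (n N : nat).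
Variable mu : probability 'rV[R]_n R.

(** Continuity along sequences, coordinate by coordinate: the form in which [nearest_cvg] supplies
    convergence and dominated convergence consumes it. *)
Definition seq_continuous (X : 'rV[R]_n -> 'rV[R]_N) : Prop :=
  forall (y_ : nat -> 'rV[R]_n) (y : 'rV[R]_n),
    (forall l, y_ m ord0 l @[m --> \oo] --> y ord0 l) ->
    forall l, X (y_ m) ord0 l @[m --> \oo] --> X y ord0 l.

Lemma measurable_nearest_comp d (Z : measurableType d) m (h : nat -> Z) :
  measurable_fun setT (fun y : 'rV[R]_n => h (nearest m y)).
Proof.
move=> _ A mA; rewrite setTI.
rewrite (_ : _ @^-1` A = \bigcup_j ([set y | nearest m y = j] `&` [set _ | A (h j)])).
  apply: bigcupT_measurable => j; have [hA|hA] := pselect (A (h j)).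
    rewrite (_ : [set _ | A (h j)] = setT) ?setIT; first exact: measurable_nearest.
    by apply/seteqP; split.
  rewrite (_ : [set _ | A (h j)] = set0) ?setI0//.
  by apply/seteqP; split.
by apply/seteqP; split => [y /= hy|y [j _ [/= <-]]]//; exists (nearest m y).
Qed.

Lemma cvg_lgauss (v_ : nat -> 'rV[R]_N) (v : 'rV[R]_N) :
  (forall l, v_ m ord0 l @[m --> \oo] --> v ord0 l) ->
  expR (lgauss s (v_ m)) @[m --> \oo] --> expR (lgauss s v).
Proof.
move=> vv; apply: continuous_cvg; first exact: continuous_expR.
apply: cvgB; first exact: cvg_cst.
apply: cvgMr_tmp; apply: cvg_big => [|l _].
  exact: add_continuous.
by under eq_cvg do rewrite expr2; rewrite expr2; exact: cvgM.
Qed.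

Section X.
Variables (X : 'rV[R]_n -> 'rV[R]_N).
Hypothesis (mX : measurable_fun setT X) (cX : seq_continuous X).

(** Rounding happens before X is applied, so two maps discretized this way share their weights and
    their pairing of atoms. *)
Definition discretize m (y : 'rV[R]_n) := X (rat_rV n (nearest m y)).

Lemma measurable_discretize m : measurable_fun setT (discretize m).
Proof. exact: (@measurable_nearest_comp _ _ m (fun j => X (rat_rV n j))). Qed.

Lemma discretize_cvg y l : discretize m y ord0 l @[m --> \oo] --> X y ord0 l.
Proof. by apply: cX => k; exact: nearest_cvg. Qed.

Lemma density_discretize m x : density s mu (discretize m) x =
  mixture s (@nearest_weight R n mu m) (fun j => X (rat_rV n j)) x.
Proof.
apply: EFin_inj; rewrite -densityE//; last exact: measurable_discretize.
exact: (ge0_integral_nearest mu m (fun j => expR_ge0 (lgauss s (x - X (rat_rV n j))))).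
Qed.

(** The point moves along with the mixture because the density is later evaluated at z +
    [discretize m y]. *)
Lemma density_cvg (x_ : nat -> 'rV[R]_N) (x : 'rV[R]_N) :
  (forall l, x_ m ord0 l @[m --> \oo] --> x ord0 l) ->
  density s mu (discretize m) (x_ m) @[m --> \oo] --> density s mu X x.
Proof.
move=> xx; apply: fine_cvg; rewrite -densityE//.
apply: (@cvg_integral_dominated _ _ _ _ _ _ (cst (expR (lgauss s (0 : 'rV[R]_N))))).
- by move=> m; apply: measurable_gauss_subr => //; exact: measurable_discretize.
- move=> y; apply: cvg_lgauss => l; under eq_cvg do rewrite !mxE.
  by rewrite !mxE; apply: cvgB => //; exact: discretize_cvg.
- by move=> m y; rewrite /= ger0_norm ?expR_ge0// ler_expR lgauss_le0.
- exact: finite_measure_integrable_cst.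
Qed.

Variables (eta : R -> R) (B : R).
Hypothesis eta_cont : continuous eta.
Hypothesis eta_bnd : forall t, 0 <= eta t <= B.

(** The contribution of a single atom p: the mean of eta(ln D) under the Gaussian centred at p. *)
Definition gauss_mean (D : 'rV[R]_N -> R) (p : 'rV[R]_N) : R :=
  (\int[lebesgue_rV N]_z (expR (lgauss s z) * eta (ln (D (z + p)))))%R.

Let B_ge0 : 0 <= B.
Proof. by have /andP[h1 h2] := eta_bnd 0; exact: le_trans h2. Qed.

Lemma measurable_gauss_eta (D : 'rV[R]_N -> R) p : measurable_fun setT D ->
  measurable_fun setT (fun z : 'rV[R]_N => expR (lgauss s z) * eta (ln (D (z + p)))).
Proof.
move=> mD; apply: measurable_funM; first exact: measurable_gauss.
have mDp : measurable_fun setT (fun z : 'rV[R]_N => D (z + p)).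
  by apply: (measurableT_comp mD); exact: measurable_rVD.
have mln : measurable_fun setT (fun z : 'rV[R]_N => ln (D (z + p))).
  exact: measurableT_comp.
exact: (measurableT_comp (continuous_measurable_fun eta_cont) mln).
Qed.

Lemma gauss_eta_bnd (D : 'rV[R]_N -> R) p (z : 'rV[R]_N) :
  `|expR (lgauss s z) * eta (ln (D (z + p)))| <= B * expR (lgauss s z).
Proof.
have /andP[h1 h2] := eta_bnd (ln (D (z + p))).
by rewrite ger0_norm ?mulr_ge0 ?expR_ge0// mulrC ler_wpM2r ?expR_ge0.
Qed.

Lemma integrable_gauss_bnd :
  (lebesgue_rV N).-integrable setT (EFin \o (fun z => B * expR (lgauss s z))).
Proof.
rewrite (_ : _ \o _ = (fun z => B%:E * (expR (lgauss s z))%:E)%E)//.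
by apply: integrableZl => //; exact: integrable_gauss.
Qed.

Lemma integrable_gauss_eta (D : 'rV[R]_N -> R) p : measurable_fun setT D ->
  (lebesgue_rV N).-integrable setT
    (fun z => (expR (lgauss s z) * eta (ln (D (z + p))))%:E).
Proof.
move=> mD; apply: (le_integrable _ _ _ integrable_gauss_bnd) => //.
  by apply/measurable_EFinP; exact: measurable_gauss_eta.
move=> z _; rewrite /= lee_fin; apply: le_trans (gauss_eta_bnd _ _ _) _.
exact: ler_norm.
Qed.

Lemma gauss_meanE (D : 'rV[R]_N -> R) p : measurable_fun setT D ->
  (\int[lebesgue_rV N]_z (expR (lgauss s z) * eta (ln (D (z + p))))%:E =
   (gauss_mean D p)%:E)%E.
Proof.
move=> mD; rewrite /gauss_mean /Rintegral fineK//; apply: integrable_fin_num => //.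
exact: integrable_gauss_eta.
Qed.

Lemma gauss_mean_ge0 D p : 0 <= gauss_mean D p.
Proof.
apply: Rintegral_ge0 => z _; rewrite mulr_ge0 ?expR_ge0//.
by have /andP[] := eta_bnd (ln (D (z + p))).
Qed.

Lemma gauss_mean_le D p : measurable_fun setT D -> gauss_mean D p <= B.
Proof.
move=> mD; rewrite -lee_fin -gauss_meanE//.
have <- : (\int[lebesgue_rV N]_z (B * expR (lgauss s z))%:E = B%:E)%E.
  under eq_integral do rewrite EFinM.
  rewrite integralZl//; last exact: integrable_gauss.
  by rewrite integral_gauss// mule1.
apply: le_integral => //; [exact: integrable_gauss_eta|exact: integrable_gauss_bnd|].
move=> z _; rewrite lee_fin; apply: le_trans (gauss_eta_bnd _ _ _); exact: ler_norm.
Qed.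

Lemma gauss_mean_cvg y :
  gauss_mean (density s mu (discretize m)) (discretize m y) @[m --> \oo] -->
  gauss_mean (density s mu X) (X y).
Proof.
apply: fine_cvg; rewrite -/(gauss_mean _ _) -gauss_meanE; last exact: measurable_density.
apply: (cvg_integral_dominated _ _ _ integrable_gauss_bnd).
- move=> m; apply: measurable_gauss_eta; apply: measurable_density => //.
  exact: measurable_discretize.
- move=> z; apply: cvgMl_tmp; apply: continuous_cvg; first exact: eta_cont.
  apply: continuous_cvg; first by apply: continuous_ln; exact: density_gt0.
  apply: density_cvg => l; under eq_cvg do rewrite !mxE.
  by rewrite !mxE; apply: cvgD; [exact: cvg_cst|exact: discretize_cvg].
- by move=> m z; exact: gauss_eta_bnd.
Qed.

Lemma integral_gauss_mean_cvg :
  (\int[mu]_y (gauss_mean (density s mu (discretize m)) (discretize m y))%:E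
     @[m --> \oo] -->
   \int[mu]_y (gauss_mean (density s mu X) (X y))%:E)%E.
Proof.
apply: (@cvg_integral_dominated _ _ _ _ _ _ (cst B)).
- by move=> m; exact: (@measurable_nearest_comp _ _ m
    (fun j => gauss_mean (density s mu (discretize m)) (X (rat_rV n j)))).
- exact: gauss_mean_cvg.
- move=> m y; rewrite /= ger0_norm ?gauss_mean_ge0// gauss_mean_le//.
  by apply: measurable_density => //; exact: measurable_discretize.
- exact: finite_measure_integrable_cst.
Qed.

Lemma integral_density_eta :
  (\int[lebesgue_rV N]_x (density s mu X x * eta (ln (density s mu X x)))%:E =
   \int[mu]_y (gauss_mean (density s mu X) (X y))%:E)%E.
Proof.
rewrite (@integral_density_mul _ _ s_gt0 _ _ mu _ X mX (fun x => eta (ln (density s mu X x)))).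
- by apply: eq_integral => y _; rewrite gauss_meanE//; exact: measurable_density.
- have mln : measurable_fun setT (fun x => ln (density s mu X x)).
    by apply: measurableT_comp => //; exact: measurable_density.
  exact: (measurableT_comp (continuous_measurable_fun eta_cont) mln).
- by move=> x; have /andP[] := eta_bnd (ln (density s mu X x)).
Qed.

End X.

Variables (X Y : 'rV[R]_n -> 'rV[R]_N).
Hypothesis (mX : measurable_fun setT X) (cX : seq_continuous X).
Hypothesis (mY : measurable_fun setT Y) (cY : seq_continuous Y).
Hypothesis XY_orth : forall y z,
  \sum_l (X y - X z) ord0 l * (Y y - Y z) ord0 l = 0.
Hypothesis YX_le : forall y z,
  \sum_l (Y y - Y z) ord0 l ^+ 2 <= \sum_l (X y - X z) ord0 l ^+ 2.
Variables (eta deta : R -> R) (B : R).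
Hypothesis eta_is_derive : forall t : R, is_derive t 1 eta (deta t).
Hypothesis deta_cont : continuous deta.
Hypothesis eta_bnd : forall t : R, 0 <= eta t <= B.
Hypothesis deta_bnd : forall t : R, - B <= deta t <= 0.

(** [mixture_contraction] applies to the discretized maps, and both sides converge by
    [integral_gauss_mean_cvg]. *)
Lemma density_contraction_smooth :
  (\int[lebesgue_rV N]_x (density s mu Y x * eta (ln (density s mu Y x)))%:E <=
   \int[lebesgue_rV N]_x (density s mu X x * eta (ln (density s mu X x)))%:E)%E.
Proof.
have eta_cont : continuous eta.
  by move=> t; exact: (is_derive1_continuous (eta_is_derive t)).
have EX := integral_density_eta mX eta_cont eta_bnd.
have EY := integral_density_eta mY eta_cont eta_bnd.
rewrite [leRHS]EX [leLHS]EY {EX EY}.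
apply: lee_cvg_to (integral_gauss_mean_cvg mY cY eta_cont eta_bnd)
                  (integral_gauss_mean_cvg mX cX eta_cont eta_bnd) _.
apply: nearW => m.
have E Z : (\int[mu]_y (gauss_mean eta (density s mu (discretize Z m)) (discretize Z m y))%:E =
   (\sum_(j < m.+1) nearest_weight mu j *
      gauss_mean eta (mixture s (@nearest_weight R n mu m) (fun j => Z (rat_rV n j)))
        (Z (rat_rV n j)))%:E)%E.
  have -> : density s mu (discretize Z m) =
      mixture s (@nearest_weight R n mu m) (fun j => Z (rat_rV n j)).
    by apply/funext => x; exact: density_discretize.
  exact: (ge0_integral_nearest mu m (fun j => gauss_mean_ge0 eta_bnd
    (mixture s (@nearest_weight R n mu m) (fun j => Z (rat_rV n j))) (Z (rat_rV n j)))).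
rewrite [leLHS]E [leRHS]E lee_fin.
apply: (@mixture_contraction _ _ _ _ s_gt0 _ _ _ eta deta B) => //.
- exact: nearest_weight_ge0.
- by rewrite nearest_weight_sum.
- by move=> t; have /andP[h1 h2] := eta_bnd t; rewrite ger0_norm.
Qed.

End discretization.

(** * Primitives on the whole line, and regularization of [eta] *)

Section primitive.
Context {R : realType}.
Notation leb := (@lebesgue_measure R).

Lemma primitive_ex (f : R -> R) : continuous f ->
  {F : R -> R | forall x : R, is_derive x 1 F (f x)}.
Proof.
move=> cf.
have fi a b : leb.-integrable `[a, b] (EFin \o f).
  apply: continuous_compact_integrable; first exact: segment_compact.
  exact: continuous_subspaceT.
pose G a x := (\int[leb]_(t in `[a, x]) f t)%R.
pose F x := if 0 <= x then (\int[leb]_(t in `]0%R, x]) f t)%R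
            else - (\int[leb]_(t in `]x, 0%R]) f t)%R.
have FE a x : a < 0 -> a < x -> F x = G a x - G a 0.
  move=> a0 ax; rewrite /F /G; case: ifPn => x0.
    by rewrite Rintegral_itvB// bnd_simp// ltW.
  rewrite -(@Rintegral_itvB _ f (BLeft a) (BRight 0) x)//; first by rewrite opprB.
    by rewrite bnd_simp ltW.
  by rewrite bnd_simp ltW// ltNge.
exists F => x.
(* A base point to the left of both 0 and x: near x, the signed integral F from 0 is the integral
   from a minus a constant, to which the fundamental theorem applies. *)
pose a := - `|x| - 1.
have ax : a < x by have := ler_norm (- x); rewrite normrN /a; lra.
have a0 : a < 0 by have := normr_ge0 x; rewrite /a; lra.
have xu : x < x + 1 by rewrite ltrDl.
have [dG GE] := continuous_FTC1_closed xu (fi a (x + 1)) ax (cf x).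
have dG' : is_derive x 1 (fun y => G a y - G a 0) (f x).
  apply: (is_derive_eq (is_derive1B (DeriveDef dG (etrans (esym (derive1E _ _)) GE))
    (is_derive1_cst _ _))).
  by rewrite subr0.
apply: near_eq_is_derive dG'.
by near=> y; rewrite (FE a)//; near: y; exact: lt_nbhsr.
Unshelve. all: by end_near. Qed.

(** Made total so that it can be iterated; f itself is the default off continuous functions. Only
    the derivative is recorded: the integration constants in a k-th primitive form a polynomial of
    degree < k, which k-th differences annihilate. *)
Definition primitive (f : R -> R) : R -> R :=
  if pselect (continuous f) is left cf then sval (primitive_ex cf) else f.

Lemma is_derive_primitive f (x : R) : continuous f ->
  is_derive x 1 (primitive f) (f x).
Proof.
move=> cf; rewrite /primitive; case: pselect => // cf'.
exact: (svalP (primitive_ex cf')).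
Qed.

Lemma continuous_primitive f : continuous f -> continuous (primitive f).
Proof. by move=> cf x; exact: (is_derive1_continuous (is_derive_primitive x cf)). Qed.

End primitive.

Section fatou_bound.
Local Open Scope ereal_scope.
Context d (T : measurableType d) (R : realType) (mu : {measure set T -> \bar R}).

Lemma le_integral_fatou (f_ : nat -> T -> R) (f : T -> R) (C : \bar R) :
  (forall n, measurable_fun setT (f_ n)) -> (forall n x, (0 <= f_ n x)%R) ->
  (forall x, f_ n x @[n --> \oo] --> f x) ->
  (forall n, \int[mu]_x (f_ n x)%:E <= C) ->
  \int[mu]_x (f x)%:E <= C.
Proof.
move=> mf f0 ff fC.
rewrite (eq_integral (fun x => limn_einf (fun n => (f_ n x)%:E))); last first.
  move=> x _; apply: esym; apply: (cvg_limn_einf_sup _).1.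
  by apply: cvg_EFin; [exact: nearW|exact: ff].
apply: le_trans (fatou mu measurableT _ _) _.
- by move=> n; exact/measurable_EFinP.
- by move=> n x _; rewrite lee_fin.
rewrite limn_einf_lim; apply: lime_le; first exact: is_cvg_einfs.
apply: nearW => n; apply: le_trans (fC n).
by apply: ereal_inf_lbound; exists n => //=.
Qed.

End fatou_bound.

Section smoothing.
Context {R : realType} (eta : R -> R).
Hypothesis eta_cont : continuous eta.
Hypothesis eta_ge0 : forall t, 0 <= eta t.
Hypothesis eta_nincr : forall t u, t <= u -> eta u <= eta t.

Let clip (m : nat) (t : R) : R := Num.min (eta t) m%:R.

Let clip_cont m : continuous (clip m).
Proof.
move=> t; have h : {for t, continuous (eta \min (cst m%:R : R -> R))}.
  by apply: continuous_min; [exact: eta_cont|exact: cst_continuous].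
exact: h.
Qed.

Let clip_nincr m t u : t <= u -> clip m u <= clip m t.
Proof. by move=> /eta_nincr tu; rewrite /clip le_min !ge_min tu lexx orbT. Qed.

(** The mean of [clip m] over [t, t + 1/(m+1)]. Averaging to the right keeps it below the
    nonincreasing [eta], clipping keeps it bounded, and its derivative is a difference quotient of
    [clip m], hence <= 0. *)
Definition smooth (m : nat) (t : R) : R :=
  m.+1%:R * (primitive (clip m) (t + m.+1%:R^-1) - primitive (clip m) t).

Definition dsmooth (m : nat) (t : R) : R :=
  m.+1%:R * (clip m (t + m.+1%:R^-1) - clip m t).

Lemma is_derive_smooth m (t : R) : is_derive t 1 (smooth m) (dsmooth m t).
Proof.
apply: is_derive1Z; apply: is_derive1B; last exact: is_derive_primitive.
have := @is_derive1_compl _ _ (fun u => u + m.+1%:R^-1) t _ _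
  (is_derive_primitive (t + m.+1%:R^-1) (@clip_cont m))
  (is_derive1D (is_derive_id t 1) (is_derive1_cst t m.+1%:R^-1)).
by rewrite addr0 mul1r.
Qed.

Lemma continuous_dsmooth m : continuous (dsmooth m).
Proof.
move=> t; apply: cvgMl_tmp; apply: cvgB; last exact: clip_cont.
apply: continuous_cvg; first exact: clip_cont.
by apply: cvgD; [exact: cvg_id|exact: cvg_cst].
Qed.

Lemma smooth_mean m t : exists2 u, t <= u <= t + m.+1%:R^-1 & smooth m t = clip m u.
Proof.
have tm : t <= t + m.+1%:R^-1 by rewrite lerDl.
have [|u] := @MVT_segment _ (primitive (clip m)) (clip m) _ _ tm
    (fun x _ => is_derive_primitive x (@clip_cont m)).
  by apply: continuous_subspaceT; apply: continuous_primitive; exact: clip_cont.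
rewrite in_itv/= => ut E; exists u => //.
by rewrite /smooth E addrAC subrr add0r mulrCA divff ?mulr1.
Qed.

Lemma clip_bnd m t : 0 <= clip m t <= m%:R.
Proof. by rewrite /clip le_min eta_ge0 ler0n ge_min lexx orbT. Qed.

(** The bound is coarse so that one constant controls both [smooth] and [dsmooth]. *)
Lemma smooth_bnd m t : 0 <= smooth m t <= m.+1%:R ^+ 2.
Proof.
have [u _ ->] := smooth_mean m t; have /andP[-> h] := clip_bnd m u.
rewrite (le_trans h)// -natrX ler_nat (leq_trans (leqnSn m))//.
by rewrite -[leqLHS]muln1 expnS leq_mul.
Qed.

Lemma dsmooth_bnd m t : - m.+1%:R ^+ 2 <= dsmooth m t <= 0.
Proof.
have /andP[a1 a2] := clip_bnd m (t + m.+1%:R^-1).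
have /andP[b1 b2] := clip_bnd m t.
rewrite /dsmooth; apply/andP; split; last first.
  by rewrite mulr_ge0_le0// subr_le0 clip_nincr// lerDl.
rewrite expr2 -mulrN ler_wpM2l// lerNl opprB lerBlDr (le_trans b2)//.
by rewrite (@le_trans _ _ m.+1%:R) ?ler_nat// lerDl.
Qed.

Lemma smooth_le m t : smooth m t <= eta t.
Proof.
have [u /andP[tu _] ->] := smooth_mean m t.
by rewrite (le_trans (clip_nincr m tu))// ge_min lexx.
Qed.

Lemma smooth_cvg t : smooth m t @[m --> \oo] --> eta t.
Proof.
apply/cvgrPdist_lt => e e0.
have /cvgrPdist_lt/(_ _ e0) := @eta_cont t.
move=> /nbhs_ballP[d /= d0 dP].
near=> m.
have [u /andP[tu um] ->] := smooth_mean m t.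
have etam : eta t <= m%:R by near: m; exact: nbhs_infty_ger.
(* As soon as m >= eta t, clipping is inactive on [t, +oo), where eta is at most eta t. *)
rewrite /clip min_l; last by rewrite (le_trans _ etam)// eta_nincr.
apply: dP; rewrite /ball/= ler0_norm ?subr_le0// opprB ltrBlDl.
apply: (le_lt_trans um); rewrite ltrD2l.
by near: m; exact: (near_infty_natSinv_lt (PosNum d0)).
Unshelve. all: by end_near. Qed.

End smoothing.

Section contraction.
Context {R : realType} (s : R) (s_gt0 : 0 < s) (n N : nat).
Variable mu : probability 'rV[R]_n R.
Variables (X Y : 'rV[R]_n -> 'rV[R]_N).
Hypothesis (mX : measurable_fun setT X) (cX : seq_continuous X).
Hypothesis (mY : measurable_fun setT Y) (cY : seq_continuous Y).
Hypothesis XY_orth : forall y z,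
  \sum_l (X y - X z) ord0 l * (Y y - Y z) ord0 l = 0.
Hypothesis YX_le : forall y z,
  \sum_l (Y y - Y z) ord0 l ^+ 2 <= \sum_l (X y - X z) ord0 l ^+ 2.
Variables (eta : R -> R).
Hypothesis eta_cont : continuous eta.
Hypothesis eta_ge0 : forall t, 0 <= eta t.
Hypothesis eta_nincr : forall t u, t <= u -> eta u <= eta t.

(** The approximations lie below [eta] and converge to it: Fatou recovers [eta] on the side of Y,
    and the pointwise bound [smooth_le] suffices on the side of X. *)
Lemma density_contraction :
  (\int[lebesgue_rV N]_x (density s mu Y x * eta (ln (density s mu Y x)))%:E <=
   \int[lebesgue_rV N]_x (density s mu X x * eta (ln (density s mu X x)))%:E)%E.
Proof.
have mln (Z : 'rV[R]_n -> 'rV[R]_N) : measurable_fun setT Z ->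
    measurable_fun setT (fun x => ln (density s mu Z x)).
  by move=> mZ; apply: measurableT_comp => //; exact: measurable_density.
have cs m : continuous (smooth eta m).
  by move=> t; exact: (is_derive1_continuous (is_derive_smooth eta_cont m t)).
have ms (Z : 'rV[R]_n -> 'rV[R]_N) m : measurable_fun setT Z ->
    measurable_fun setT (fun x => density s mu Z x * smooth eta m (ln (density s mu Z x))).
  move=> mZ; apply: measurable_funM; first exact: measurable_density.
  exact: (measurableT_comp (continuous_measurable_fun (cs m)) (mln Z mZ)).
have d0 (Z : 'rV[R]_n -> 'rV[R]_N) x : measurable_fun setT Z -> 0 <= density s mu Z x.
  by move=> mZ; rewrite ltW//; exact: density_gt0.
have s0 m t : 0 <= smooth eta m t.
  by have /andP[] := smooth_bnd eta_cont eta_ge0 m t.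
apply: (@le_integral_fatou _ _ _ _
  (fun m x => density s mu Y x * smooth eta m (ln (density s mu Y x)))).
- by move=> m; exact: ms.
- by move=> m x; rewrite mulr_ge0// d0.
- by move=> x; apply: cvgMl_tmp; exact: smooth_cvg.
move=> m.
have H := (@density_contraction_smooth _ _ s_gt0 _ _ mu X Y mX cX mY cY
  XY_orth YX_le (smooth eta m) (dsmooth eta m) (m.+1%:R ^+ 2)
  (is_derive_smooth eta_cont m) (@continuous_dsmooth _ _ eta_cont m)
  (smooth_bnd eta_cont eta_ge0 m) (dsmooth_bnd eta_ge0 eta_nincr m)).
apply: (le_trans H) => {H}.
apply: ge0_le_integral => //.
- by move=> x _; rewrite lee_fin mulr_ge0// d0.
- by apply/measurable_EFinP; exact: ms.
- apply/measurable_EFinP; apply: measurable_funM; first exact: measurable_density.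
  exact: (measurableT_comp (continuous_measurable_fun eta_cont) (mln X mX)).
- move=> x _; rewrite lee_fin ler_wpM2l ?d0//; exact: smooth_le.
Qed.

End contraction.

(** * Auxiliary Gaussian coordinates *)

Section lipschitz.
Context {R : realType} (n : nat) (T : 'rV[R]_n -> 'rV[R]_n) (T_lip : lipschitz1 T).

Lemma lipschitz1_sqr y z :
  \sum_l (T y - T z) ord0 l ^+ 2 <= \sum_l (y - z) ord0 l ^+ 2.
Proof.
rewrite -!l2norm_sqr ler_sqr ?nnegrE ?sqrtr_ge0//; exact: T_lip.
Qed.

Lemma lipschitz1_seq_continuous : seq_continuous T.
Proof.
move=> y_ y yy l.
have cvk k : (y_ m - y) ord0 k ^+ 2 @[m --> \oo] --> (0 : R).
  have h : y_ m ord0 k - y ord0 k @[m --> \oo] --> y ord0 k - y ord0 k.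
    by apply: cvgB; [exact: yy|exact: cvg_cst].
  have := cvgM h h; rewrite subrr mulr0 => h2.
  suff -> : (fun m => (y_ m - y) ord0 k ^+ 2) =
      (fun m => y_ m ord0 k - y ord0 k) \* (fun m => y_ m ord0 k - y ord0 k) by exact: h2.
  by apply: funext => m; rewrite !mxE expr2.
have cv : \sum_k (y_ m - y) ord0 k ^+ 2 @[m --> \oo] --> (0 : R).
  have := @cvg_big _ _ +%R 0 xpredT (@add_continuous _) nat _ (index_enum 'I_n)
    (fun k m => (y_ m - y) ord0 k ^+ 2) (fun=> 0) _ (fun k _ => cvk k).
  by rewrite big1_eq => cv; exact: cv.
apply/cvgrPdist_lt => e e0.
have e20 : 0 < e ^+ 2 by rewrite exprn_gt0.
move/cvgrPdist_lt : cv => /(_ _ e20); apply: filterS => m.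
rewrite sub0r normrN ger0_norm; last by apply: sumr_ge0 => k _; exact: sqr_ge0.
move=> lte; rewrite -ltr_sqr ?nnegrE// ?(ltW e0)//.
apply: le_lt_trans lte; apply: le_trans (lipschitz1_sqr _ _).
rewrite -normrX ger0_norm ?sqr_ge0// (bigD1 l)//= !mxE -sqrrN opprB lerDl.
by apply: sumr_ge0 => k _; exact: sqr_ge0.
Qed.

(** T is the pointwise limit of its compositions with rounding to [nearest], which factor through an
    index in nat. *)
Lemma lipschitz1_measurable : measurable_fun setT T.
Proof.
apply: measurable_fun_rV => l.
apply: (@measurable_fun_cvg _ _ _ _ (fun m y => T (rat_rV n (nearest m y)) ord0 l)).
  by move=> m; exact: (@measurable_nearest_comp _ _ _ _ m (fun j => T (rat_rV n j) ord0 l)).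
move=> y _; apply: lipschitz1_seq_continuous => k; exact: nearest_cvg.
Qed.

End lipschitz.

Section lift.
Context {R : realType} (s : R) (s_gt0 : 0 < s).

(* tau + lgauss s y is the logarithm of r * gauss s y for r = e^tau. *)
Definition gauss_dilate m (F : R -> \bar R) (tau : R) : \bar R :=
  (\int[lebesgue_rV m]_y F (tau + lgauss s y)%R)%E.

Lemma measurable_add_lgauss m (F : R -> \bar R) : measurable_fun setT F ->
  measurable_fun setT (fun ty : R * 'rV[R]_m => F (ty.1 + lgauss s ty.2)).
Proof.
move=> mF; apply: (measurableT_comp mF); apply: measurable_funD => //.
by apply: measurableT_comp => //; exact: measurable_lgauss.
Qed.

Lemma measurable_gauss_dilate m (F : R -> \bar R) : measurable_fun setT F ->
  (forall t, 0 <= F t)%E -> measurable_fun setT (gauss_dilate m F).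
Proof.
move=> mF F0; apply: (measurable_fun_fubini_tonelli_F
  (fun ty : R * 'rV[R]_m => F (ty.1 + lgauss s ty.2))) => //.
exact: measurable_add_lgauss.
Qed.

Lemma gauss_dilate_ge0 m (F : R -> \bar R) tau :
  (forall t, 0 <= F t)%E -> (0 <= gauss_dilate m F tau)%E.
Proof. by move=> F0; exact: integral_ge0. Qed.

Lemma gauss_dilateD a b (F : R -> \bar R) tau : measurable_fun setT F ->
  (forall t, 0 <= F t)%E ->
  gauss_dilate (a + b) F tau = gauss_dilate a (gauss_dilate b F) tau.
Proof.
move=> mF F0; rewrite /gauss_dilate.
etransitivity.
  apply: (ge0_integral_lebesgue_rV_row_mx (f := fun y => F (tau + lgauss s y))).
    by apply: (measurableT_comp mF); apply: measurable_funD => //; exact: measurable_lgauss.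
  by move=> y; exact: F0.
apply: eq_integral => x _; apply: eq_integral => y _.
by rewrite lgauss_row_mx// addrA.
Qed.

Variables (n d : nat) (mu : probability 'rV[R]_n R).
Variables (T : 'rV[R]_n -> 'rV[R]_n) (T_lip : lipschitz1 T).

(** The two ends of the curve. Atoms in different blocks give orthogonal differences; each end
    leaves n + d coordinates purely Gaussian. *)
Definition left_rV (y : 'rV[R]_n) : 'rV[R]_(n + (n + d)) := row_mx y 0.
Definition right_rV (y : 'rV[R]_n) : 'rV[R]_(n + (n + d)) :=
  row_mx 0 (row_mx (T y) 0).

Lemma density_left x z : density s mu left_rV (row_mx x z) =
  density s mu id x * expR (lgauss s z).
Proof.
have mid : measurable_fun setT (@id 'rV[R]_n) by exact: measurable_id.
rewrite /density -[RHS]/(fine _ * fine (expR (lgauss s z))%:E).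
rewrite -fineM//; last by rewrite densityE.
rewrite muleC -ge0_integralZl//; last first.
  by apply/measurable_EFinP; exact: measurable_gauss_subr.
congr fine; apply: eq_integral => y _.
by rewrite /left_rV opp_row_mx add_row_mx oppr0 addr0 lgauss_row_mx// expRD EFinM muleC.
Qed.

Lemma density_right x x' z : density s mu right_rV (row_mx x (row_mx x' z)) =
  density s mu T x' * expR (lgauss s x + lgauss s z).
Proof.
have mT := lipschitz1_measurable T_lip.
rewrite /density -[RHS]/(fine _ * fine (expR (lgauss s x + lgauss s z))%:E).
rewrite -fineM//; last by rewrite densityE.
rewrite muleC -ge0_integralZl//; last first.
  by apply/measurable_EFinP; exact: measurable_gauss_subr.
congr fine; apply: eq_integral => y _.
rewrite /right_rV !opp_row_mx !add_row_mx !oppr0 !addr0 !lgauss_row_mx//.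
by rewrite -EFinM -expRD; congr (expR _)%:E; rewrite addrCA addrC.
Qed.

Variable eta : R -> R.
Hypothesis eta_cont : continuous eta.
Hypothesis eta_ge0 : forall t, 0 <= eta t.
Hypothesis eta_nincr : forall t u, t <= u -> eta u <= eta t.

Let F (t : R) : \bar R := (expR t * eta t)%:E.

Let mF : measurable_fun setT F.
Proof.
apply/measurable_EFinP; apply: measurable_funM => //.
exact: continuous_measurable_fun.
Qed.

Let F0 t : (0 <= F t)%E.
Proof. by rewrite lee_fin mulr_ge0 ?expR_ge0. Qed.

Let FE (r : R) : 0 < r -> (r * eta (ln r))%:E = F (ln r).
Proof. by move=> r0; rewrite /F lnK. Qed.

Let mT := lipschitz1_measurable T_lip.
Let mid : measurable_fun setT (@id 'rV[R]_n).
Proof. exact: measurable_id. Qed.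

Let mleft : measurable_fun setT left_rV.
Proof. exact: measurable_row_mx. Qed.

Let mright : measurable_fun setT right_rV.
Proof. by apply: measurable_row_mx => //; exact: measurable_row_mx. Qed.

Let mFln N (X : 'rV[R]_n -> 'rV[R]_N) : measurable_fun setT X ->
  measurable_fun setT (fun x => F (ln (density s mu X x))).
Proof.
move=> mX; apply: (measurableT_comp mF).
by apply: measurableT_comp => //; exact: measurable_density.
Qed.

Let integral_left :
  (\int[lebesgue_rV (n + (n + d))]_x F (ln (density s mu left_rV x)) =
   \int[lebesgue_rV n]_x gauss_dilate (n + d) F (ln (density s mu id x)))%E.
Proof.
etransitivity; first exact: (ge0_integral_lebesgue_rV_row_mx (mFln mleft) (fun=> F0 _)).
apply: eq_integral => x _; apply: eq_integral => y _; congr F.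
rewrite density_left lnM ?posrE ?expR_gt0//; last exact: density_gt0.
by rewrite expRK.
Qed.

Let integral_right :
  (\int[lebesgue_rV (n + (n + d))]_x F (ln (density s mu right_rV x)) =
   \int[lebesgue_rV n]_x gauss_dilate (n + d) F (ln (density s mu T x)))%E.
Proof.
etransitivity; first exact: (ge0_integral_lebesgue_rV_row_mx (mFln mright) (fun=> F0 _)).
pose G (x x' : 'rV[R]_n) : \bar R :=
  gauss_dilate d F (ln (density s mu T x') + lgauss s x).
have mlnT : measurable_fun setT (fun x : 'rV[R]_n => ln (density s mu T x)).
  by apply: measurableT_comp => //; exact: measurable_density.
transitivity (\int[lebesgue_rV n]_x \int[lebesgue_rV n]_x' G x x')%E.
  apply: eq_integral => x _.
  have mx : measurable_fun setT (fun y : 'rV[R]_(n + d) =>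
      F (ln (density s mu right_rV (row_mx x y)))).
    by apply: (measurableT_comp (mFln mright)); exact: measurable_row_mx.
  etransitivity; first exact: (ge0_integral_lebesgue_rV_row_mx mx (fun=> F0 _)).
  apply: eq_integral => x' _; apply: eq_integral => z _; congr F.
  rewrite density_right lnM ?posrE ?expR_gt0//; last exact: density_gt0.
  by rewrite expRK addrA.
have mG : measurable_fun setT (fun xx : 'rV[R]_n * 'rV[R]_n => G xx.1 xx.2).
  have mfn : measurable_fun setT (fun xx : 'rV[R]_n * 'rV[R]_n =>
      ln (density s mu T xx.2) + lgauss s xx.1).
    apply: measurable_funD; first exact: (measurableT_comp mlnT measurable_snd).
    by apply: measurableT_comp => //; exact: measurable_lgauss.
  exact: (measurableT_comp (measurable_gauss_dilate d mF F0) mfn).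
have G0 (xx : 'rV[R]_n * 'rV[R]_n) : (0 <= G xx.1 xx.2)%E.
  exact: (gauss_dilate_ge0 _ _ F0).
(* The Gaussian coordinates are the first and the last block; exchanging the first two integrals
   makes them adjacent, and [gauss_dilateD] merges them. *)
etransitivity; first exact: (fubini_tonelli _ mG G0).
apply: eq_integral => x' _.
by rewrite gauss_dilateD.
Qed.

Theorem gauss_dilate_contraction :
  (\int[lebesgue_rV n]_x gauss_dilate (n + d) F (ln (density s mu T x)) <=
   \int[lebesgue_rV n]_x gauss_dilate (n + d) F (ln (density s mu id x)))%E.
Proof.
rewrite -[leLHS]integral_right -[leRHS]integral_left.
have c0 m : seq_continuous (fun=> 0 : 'rV[R]_m) by move=> *; exact: cvg_cst.
have crow a b (X : 'rV[R]_n -> 'rV[R]_a) (Y : 'rV[R]_n -> 'rV[R]_b) :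
    seq_continuous X -> seq_continuous Y -> seq_continuous (fun y => row_mx (X y) (Y y)).
  move=> cX cY y_ y yy l; case: (split_ordP l) => k ->.
    by rewrite row_mxEl; under eq_cvg do rewrite row_mxEl; exact: cX.
  by rewrite row_mxEr; under eq_cvg do rewrite row_mxEr; exact: cY.
have cl : seq_continuous left_rV by apply: crow => //; move=> *; auto.
have cr : seq_continuous right_rV.
  have cr1 := crow _ _ T (fun=> 0) (lipschitz1_seq_continuous T_lip) (c0 n d).
  exact: (crow _ _ (fun=> 0) (fun y => row_mx (T y) 0) (c0 n n) cr1).
have eX (X : 'rV[R]_n -> 'rV[R]_(n + (n + d))) : measurable_fun setT X ->
   (\int[lebesgue_rV (n + (n + d))]_x F (ln (density s mu X x)) =
   \int[lebesgue_rV (n + (n + d))]_x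
     (density s mu X x * eta (ln (density s mu X x)))%:E)%E.
  by move=> mX; apply: eq_integral => x _; rewrite FE//; exact: density_gt0.
rewrite [leLHS](eX _ mright) [leRHS](eX _ mleft).
apply: density_contraction => // y z.
- apply: big1 => l _; rewrite /left_rV /right_rV !opp_row_mx !add_row_mx.
  case: (split_ordP l) => k ->.
    by rewrite !row_mxEl !mxE subrr mulr0.
  by rewrite !row_mxEr !mxE subrr mul0r.
- rewrite /left_rV /right_rV !opp_row_mx !add_row_mx !subrr.
  have sq0 a : \sum_(l < a) (0 : 'rV[R]_a) ord0 l ^+ 2 = 0.
    by apply: big1 => l _; rewrite mxE expr0n.
  have sq a b (u : 'rV[R]_a) (v : 'rV[R]_b) : \sum_l row_mx u v ord0 l ^+ 2 =
      \sum_l u ord0 l ^+ 2 + \sum_l v ord0 l ^+ 2.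
    rewrite big_split_ord/=.
    by congr (_ + _); apply: eq_bigr => l _; rewrite (row_mxEl, row_mxEr).
  by rewrite !sq !sq0 !addr0 add0r; exact: lipschitz1_sqr.
Qed.

End lift.

(** * Radial integrals over the plane *)

Section polar.
Context {R : realType}.
Notation leb := (@lebesgue_measure R).
Local Notation RR := (measurableTypeR R).

Let continuous_sqr : continuous (fun u : R => u ^+ 2).
Proof. exact: exprn_continuous. Qed.

Section polar_function.
Variables (Phi Psi : R -> R) (l : R).
Hypothesis Phi_cont : continuous Phi.
Hypothesis Phi_ge0 : forall t, 0 <= t -> 0 <= Phi t.
Hypothesis Psi_derive : forall t : R, is_derive t 1 Psi (Phi t).
Hypothesis Psi_cvg : Psi t @[t --> +oo] --> l.

(** By evenness twice the integral over u >= 0, where Psi(c u^2) / (2c) is a primitive. *)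
Lemma integral_radial (c : R) : 0 < c ->
  (\int[leb]_u (`|u| * Phi (u ^+ 2 * c))%:E = (c^-1 * (l - Psi 0))%:E)%E.
Proof.
move=> c0.
have cc : continuous (fun u : R => u ^+ 2 * c).
  by move=> u; apply: cvgMr_tmp; exact: continuous_sqr.
have cPhi : continuous (fun u : R => Phi (u ^+ 2 * c)).
  by move=> u; exact: (continuous_comp (cc u) (@Phi_cont _)).
have P0 u : 0 <= Phi (u ^+ 2 * c) by rewrite Phi_ge0// mulr_ge0 ?sqr_ge0 ?ltW.
rewrite ge0_symfun_integralT; last 3 first.
- by move=> u; rewrite mulr_ge0.
- by move=> u; apply: cvgM; [exact: norm_continuous|exact: cPhi].
- by move=> u /=; rewrite normrN sqrrN.
rewrite -set_itvcy.
transitivity (2%:E * \int[leb]_(u in `[0%R, +oo[) (u * Phi (u ^+ 2 * c))%:E)%E.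
  congr (_ * _)%E; apply: eq_integral => u.
  by rewrite inE/= in_itv/= andbT => u0; rewrite ger0_norm.
pose F (u : R) := (2 * c)^-1 * Psi (u ^+ 2 * c).
have Fd (u : R) : is_derive u 1 F (u * Phi (u ^+ 2 * c)).
  have h1 : is_derive u 1 (fun u : R => u ^+ 2 * c) (2 * u * c).
    apply: (is_derive_eq (is_derive1M (is_derive1M (is_derive_id u 1) (is_derive_id u 1))
      (is_derive1_cst u c))).
    by ring.
  have h2 := is_derive1Z (2 * c)^-1 (is_derive1_compl (Psi_derive _) h1).
  apply: (is_derive_eq h2); rewrite invfM.
  by field; rewrite gt_eqF.
rewrite (@ge0_continuous_FTC2y _ _ F _ ((2 * c)^-1 * l)).
- rewrite /F expr0n mul0r -EFinB -EFinM -mulrBr; congr EFin.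
  by field; rewrite gt_eqF.
- by move=> u u0; rewrite mulr_ge0.
- apply: continuous_subspaceT => u; apply: cvgM; [exact: cvg_id|exact: cPhi].
- apply: cvgMl_tmp; apply: cvg_comp Psi_cvg.
  apply/cvgryPge => A; near=> u.
  have u1 : 1 <= u by near: u; exact: nbhs_pinfty_ge.
  have uA : A / c <= u by near: u; apply: nbhs_pinfty_ge; exact: num_real.
  rewrite -ler_pdivrMr//; apply: (le_trans uA).
  by rewrite expr2 ler_peMr// (le_trans ler01).
- by move=> u _; have [] := Fd u.
- by apply: cvg_at_right_filter; exact: (is_derive1_continuous (Fd 0)).
- by move=> u _; rewrite derive1E; exact: derive_val.
Unshelve. all: by end_near. Qed.

Let mPhi2 : measurable_fun setT (fun uv : RR * RR => Phi ((uv.1 : R) ^+ 2 + (uv.2 : R) ^+ 2)).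
Proof.
have h : measurable_fun setT (fun uv : RR * RR => (uv.1 : R) ^+ 2 + (uv.2 : R) ^+ 2).
  by apply: measurable_funD; apply: measurable_funX;
    [exact: measurable_fst|exact: measurable_snd].
exact: (measurableT_comp (continuous_measurable_fun Phi_cont) h).
Qed.

Let mPhi3 : measurable_fun setT
  (fun ux : RR * RR => `|(ux.1 : R)| * Phi ((ux.1 : R) ^+ 2 * (1 + (ux.2 : R) ^+ 2))).
Proof.
have h : measurable_fun setT (fun ux : RR * RR => (ux.1 : R) ^+ 2 * (1 + (ux.2 : R) ^+ 2)).
  apply: measurable_funM; first by apply: measurable_funX; exact: measurable_fst.
  by apply: measurable_funD => //; apply: measurable_funX; exact: measurable_snd.
apply: measurable_funM.
  by apply: measurableT_comp => //; exact: measurable_fst.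
exact: (measurableT_comp (continuous_measurable_fun Phi_cont) h).
Qed.

(* The substitution v = |u| x stands in for polar coordinates. *)
Lemma integral_slope (u : R) : u != 0 ->
  (\int[leb]_v (Phi (u ^+ 2 + v ^+ 2))%:E =
   \int[leb]_x (`|u| * Phi (u ^+ 2 * (1 + x ^+ 2)))%:E)%E.
Proof.
move=> u0; have nu0 : 0 < `|u| by rewrite normr_gt0.
pose F (x : R) := `|u| * x.
have Fd (x : R) : is_derive x 1 F `|u|.
  by apply: (is_derive_eq (is_derive1Z `|u| (is_derive_id x 1))); rewrite mulr1.
have F'E : derive1 F = cst `|u|.
  by apply/funext => x; rewrite derive1E; exact: derive_val.
rewrite (@increasing_ge0_integration_by_substitutionT _ F (fun v => Phi (u ^+ 2 + v ^+ 2))).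
- apply: eq_integral => x _; rewrite F'E; congr EFin.
  rewrite /= mulrC; congr (_ * Phi _).
  by rewrite /F exprMn real_normK ?num_real// mulrDr mulr1.
- by move=> x y xy; rewrite /F ltr_pM2l.
- by rewrite F'E => ?; exact: cvg_cst.
- by rewrite F'E; exact: is_cvg_cst.
- by rewrite F'E; exact: is_cvg_cst.
- by move=> x; have [] := Fd x.
- by apply/gt0_cvgMrNy => //; exact: cvg_id.
- by apply/gt0_cvgMry => //; exact: cvg_id.
- have cv : continuous (fun v : R => u ^+ 2 + v ^+ 2).
    by move=> v; apply: cvgD; [exact: cvg_cst|exact: continuous_sqr].
  by move=> v; exact: (continuous_comp (cv v) (@Phi_cont _)).
- by move=> v; rewrite Phi_ge0// addr_ge0 ?sqr_ge0.
Qed.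

(** With slope coordinates (u, x), Tonelli puts x outside; for each x the inner integral is radial
    in u with c = 1 + x^2. *)
Lemma integral_radial2 :
  (\int[leb]_u \int[leb]_v (Phi (u ^+ 2 + v ^+ 2))%:E =
   (\int[leb]_x ((1 + x ^+ 2)^-1)%:E) * (l - Psi 0)%:E)%E.
Proof.
have P2 (uv : RR * RR) : (0 <= (Phi ((uv.1 : R) ^+ 2 + (uv.2 : R) ^+ 2))%:E)%E.
  by rewrite lee_fin Phi_ge0// addr_ge0 ?sqr_ge0.
have P3 (ux : RR * RR) : (0 <= (`|(ux.1 : R)| * Phi ((ux.1 : R) ^+ 2 * (1 + (ux.2 : R) ^+ 2)))%:E)%E.
  by rewrite lee_fin mulr_ge0// Phi_ge0// mulr_ge0 ?sqr_ge0// addr_ge0 ?sqr_ge0.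
have m2 : measurable_fun setT (fun uv : RR * RR => (Phi ((uv.1 : R) ^+ 2 + (uv.2 : R) ^+ 2))%:E).
  exact/measurable_EFinP.
have m3 : measurable_fun setT (fun ux : RR * RR =>
    (`|(ux.1 : R)| * Phi ((ux.1 : R) ^+ 2 * (1 + (ux.2 : R) ^+ 2)))%:E).
  exact/measurable_EFinP.
transitivity (\int[leb]_u \int[leb]_x (`|u| * Phi (u ^+ 2 * (1 + x ^+ 2)))%:E)%E.
  apply: ae_eq_integral => //.
  - exact: (measurable_fun_fubini_tonelli_F _ m2 P2).
  - exact: (measurable_fun_fubini_tonelli_F _ m3 P3).
  (* The substitution v = |u| x degenerates only on the null set u = 0. *)
  exists [set 0]; split; [exact: measurable_set1|exact: lebesgue_measure_set1|].
  move=> u /= h; apply: contrapT => u0; apply: h => _; apply: integral_slope.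
  exact/eqP.
etransitivity; first exact: (fubini_tonelli _ m3 P3).
have x1 (x : R) : 0 < 1 + x ^+ 2 by rewrite ltr_wpDr ?sqr_ge0.
have l0 : 0 <= l - Psi 0.
  rewrite -[leRHS]mul1r -[X in X * _]invr1 -lee_fin -integral_radial//.
  by apply: integral_ge0 => u _; rewrite lee_fin mulr_ge0// Phi_ge0// mulr1 sqr_ge0.
rewrite -ge0_integralZr//; last 2 first.
- apply/measurable_EFinP; apply: continuous_measurable_fun => x.
  apply: cvgV; first by rewrite gt_eqF.
  by apply: cvgD; [exact: cvg_cst|exact: continuous_sqr].
- by move=> x _; rewrite lee_fin invr_ge0 ltW.
apply: eq_integral => x _; rewrite -EFinM; exact: (integral_radial (x1 x)).
Qed.

End polar_function.

(** [integral_radial2] is run backwards with Phi(t) = e^-t: its left-hand side is then the square of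
    the Gaussian integral, which is pi. *)
Lemma integral_cauchy : (\int[leb]_x ((1 + x ^+ 2)^-1)%:E = pi%:E :> \bar R)%E.
Proof.
have Phid (t : R) : is_derive t 1 (fun t : R => - expR (- t)) (expR (- t)).
  have h := is_derive1Z (-1) (@is_derive1_compl _ expR (fun u => -1 * u) t _ _
    (is_derive_expR (-1 * t)) (is_derive1Z (-1) (is_derive_id t 1))).
  rewrite (_ : (fun t => _) = (fun t : R => -1 * expR (-1 * t))).
    by apply: (is_derive_eq h); rewrite mulN1r; ring.
  by apply/funext => u; rewrite !mulN1r.
have ce : continuous (fun t : R => expR (- t)).
  move=> t; apply: continuous_cvg; first exact: continuous_expR.
  exact: continuousN.
have cv : - expR (- t) @[t --> +oo] --> (0 : R).
  by rewrite -[X in _ --> X]oppr0; apply: cvgN; exact: cvgr_expR.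
have := integral_radial2 ce (fun t _ => expR_ge0 (- t)) Phid cv.
rewrite oppr0 expR0 sub0r opprK mule1 => <-.
under eq_integral => u _.
  under eq_integral do rewrite opprD expRD EFinM.
  rewrite ge0_integralZl//; last first.
    by apply/measurable_EFinP; exact: measurable_gauss_fun.
  rewrite (@integralT_gauss R) muleC; over.
rewrite ge0_integralZl//; last first.
  by apply/measurable_EFinP; exact: measurable_gauss_fun.
by rewrite (@integralT_gauss R) -EFinM -expr2 sqr_sqrtr// pi_ge0.
Qed.

End polar.

Section gauss_dilate_double.
Context {R : realType} (s : R) (s_gt0 : 0 < s).
Notation leb := (@lebesgue_measure R).
Let ell : R := ln (2 * pi * s).

Let pis : 0 < 2 * pi * s :> R.
Proof. by rewrite !mulr_gt0// pi_gt0. Qed.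

Lemma gauss_dilate0 (G : R -> \bar R) tau : measurable_fun setT G ->
  gauss_dilate s 0 G tau = G tau.
Proof.
move=> mG; rewrite /gauss_dilate.
rewrite (@eq_measure_integral _ _ _ _ (dirac (0 : 'rV[R]_0)))//.
rewrite integral_dirac//=.
  rewrite diracT mul1e /lgauss big_ord0 !mul0r oppr0 addr0; congr G.
  by rewrite addr0.
apply: (measurableT_comp mG); apply: measurable_funD => //.
exact: measurable_lgauss.
Qed.

Lemma gauss_dilate1 (G : R -> \bar R) tau : measurable_fun setT G ->
  (forall t, 0 <= G t)%E ->
  gauss_dilate s 1 G tau = (\int[leb]_u G (tau + lgauss1 s u)%R)%E.
Proof.
move=> mG G0; rewrite /gauss_dilate.
have mf : measurable_fun setT (fun y : 'rV[R]_1 => G (tau + lgauss s y)).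
  apply: (measurableT_comp mG); apply: measurable_funD => //.
  exact: measurable_lgauss.
etransitivity; first exact: (ge0_integral_lebesgue_rV_cons mf (fun=> G0 _)).
apply: eq_integral => u _.
have := gauss_dilate0 (tau + lgauss1 s u) mG; rewrite /gauss_dilate => <-.
by apply: eq_integral => v _; rewrite lgauss_cons// addrA.
Qed.

(** With r = u^2 + v^2 the argument of G is tau - ell - r/(2s). It stays below tau - ell, so G has
    to agree with H only up to t0. The factor 2 pi s is pi from the angular integral times 2s from
    the change of variable r. *)
Lemma gauss_dilate2 (G : R -> \bar R) (H K : R -> R) (t0 : R) :
  measurable_fun setT G -> (forall t, 0 <= G t)%E ->
  continuous H -> (forall t, t <= t0 -> 0 <= H t) ->
  (forall t, t <= t0 -> G t = (H t)%:E) ->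
  (forall t : R, is_derive t 1 K (H t)) ->
  K t @[t --> -oo] --> (0 : R) ->
  forall tau, tau - ell <= t0 ->
  gauss_dilate s 2 G tau = (2 * pi * s * K (tau - ell))%:E.
Proof.
move=> mG G0 cH H0 GH Kd Kcv tau taut.
rewrite (@gauss_dilateD R s s_gt0 1 1)//.
have mG1 := measurable_gauss_dilate s 1 mG G0.
rewrite gauss_dilate1//; last by move=> t; exact: gauss_dilate_ge0.
pose a (t : R) : R := (tau - ell) - (2 * s)^-1 * t.
have s2 : 0 < (2 * s)^-1 by rewrite invr_gt0 mulr_gt0.
have ca : continuous a.
  by move=> t; apply: cvgB; [exact: cvg_cst|apply: cvgMl_tmp; exact: cvg_id].
have a_le t : 0 <= t -> a t <= t0.
  by move=> tge; rewrite /a (le_trans _ taut)// gerBl mulr_ge0// ltW.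
pose Phi t := H (a t); pose Psi t := - (2 * s) * K (a t).
have cPhi : continuous Phi by move=> t; exact: (continuous_comp (ca t) (@cH _)).
have Phi0 t : 0 <= t -> 0 <= Phi t by move=> /a_le/H0.
have Psid (t : R) : is_derive t 1 Psi (Phi t).
  have ad : is_derive t 1 a (- (2 * s)^-1).
    apply: (is_derive_eq (is_derive1B (is_derive1_cst t _)
      (is_derive1Z (2 * s)^-1 (is_derive_id t 1)))).
    by rewrite mulr1 sub0r.
  apply: (is_derive_eq (is_derive1Z _ (is_derive1_compl (Kd (a t)) ad))).
  by rewrite mulrA mulrNN mulfV ?mul1r// gt_eqF// mulr_gt0.
have Psicv : Psi t @[t --> +oo] --> - (2 * s) * 0.
  apply: cvgMl_tmp; apply: cvg_comp Kcv.
  apply/cvgrNyPle => A; near=> t.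
  have ht : (2 * s) * (tau - ell - A) <= t.
    by near: t; apply: nbhs_pinfty_ge; exact: num_real.
  rewrite /a lerBlDr -lerBlDl -[leLHS](mulKf (lt0r_neq0 (mulr_gt0 (ltr0n R 2) s_gt0))).
  by rewrite ler_pM2l.
transitivity (\int[leb]_u \int[leb]_v (Phi (u ^+ 2 + v ^+ 2))%:E)%E.
  apply: eq_integral => u _; rewrite gauss_dilate1//; apply: eq_integral => v _.
  have -> : tau + lgauss1 s u + lgauss1 s v = a (u ^+ 2 + v ^+ 2).
    by rewrite /a /lgauss1 -/ell; field; rewrite gt_eqF.
  by rewrite GH// a_le// addr_ge0 ?sqr_ge0.
etransitivity; first exact: (integral_radial2 cPhi Phi0 Psid Psicv).
rewrite integral_cauchy -EFinM /Psi /a mulr0 mulr0 subr0; congr EFin; ring.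
Unshelve. all: by end_near. Qed.

Variables (k : nat) (W : nat -> R -> R) (tmax : R) (F : R -> \bar R).
Hypothesis mF : measurable_fun setT F.
Hypothesis F_ge0 : forall t, (0 <= F t)%E.
Hypothesis W0_cont : continuous (W 0).
Hypothesis W_derive : forall j (t : R), (j < k)%N -> is_derive t 1 (W j.+1) (W j t).
Hypothesis W_cvg : forall j, (j < k)%N -> W j.+1 t @[t --> -oo] --> (0 : R).
Hypothesis FW : forall t, t + k%:R * ell <= tmax ->
  F t = (expR (- (k%:R * ell)) * W 0 (t + k%:R * ell))%:E.

Let W_cont j : (j <= k)%N -> continuous (W j).
Proof.
case: j => [_|j jk]; first exact: W0_cont.
by move=> t; exact: (is_derive1_continuous (W_derive t jk)).
Qed.

(** Each pair of coordinates translates by -ell and multiplies by 2 pi s = e^ell. F is prepared with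
    k such shifts in advance; (k - j) ell is what is still outstanding after j pairs. *)
Let step j tau : (j <= k)%N -> tau + (k%:R - j%:R) * ell <= tmax ->
  gauss_dilate s j.*2 F tau =
  (expR (- ((k%:R - j%:R) * ell)) * W j (tau + (k%:R - j%:R) * ell))%:E.
Proof.
elim: j tau => [|j IH] tau jk taut.
  rewrite double0 gauss_dilate0// subr0; apply: FW.
  by move: taut; rewrite subr0.
rewrite doubleS (@gauss_dilateD R s s_gt0 2 j.*2)//.
pose e := (k%:R - j%:R) * ell.
have mG := measurable_gauss_dilate s j.*2 mF F_ge0.
have G0 t : (0 <= gauss_dilate s j.*2 F t)%E by exact: gauss_dilate_ge0.
have shift_d (t : R) : is_derive t 1 (fun t => t + e) 1.
  by apply: (is_derive_eq (is_derive1D (is_derive_id t 1) (is_derive1_cst t e))); rewrite addr0.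
have GH t : t <= tmax - e -> gauss_dilate s j.*2 F t = (expR (- e) * W j (t + e))%:E.
  by move=> tt; apply: IH; rewrite ?(ltnW jk)// -lerBrDr.
have cH : continuous (fun t => expR (- e) * W j (t + e)).
  move=> t; apply: cvgMl_tmp.
  exact: (continuous_comp (is_derive1_continuous (shift_d t)) (@W_cont _ (ltnW jk) _)).
have H0 t : t <= tmax - e -> 0 <= expR (- e) * W j (t + e).
  by move=> tt; rewrite -lee_fin -GH.
have Kd (t : R) : is_derive t 1 (fun t => expR (- e) * W j.+1 (t + e))
    (expR (- e) * W j (t + e)).
  apply: is_derive1Z.
  apply: (is_derive_eq (@is_derive1_compl _ (W j.+1) (fun t => t + e) t _ _
     (W_derive _ jk) (shift_d t))).
  by rewrite mul1r.
have Kcv : expR (- e) * W j.+1 (t + e) @[t --> -oo] --> (0 : R).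
  rewrite -[X in _ --> X](mulr0 (expR (- e))); apply: cvgMl_tmp.
  apply: (cvg_comp (fun t => t + e) (W j.+1)) (W_cvg jk).
  apply/cvgrNyPle => A; near=> t.
  have tA : t <= A - e by near: t; apply: nbhs_ninfty_le; exact: num_real.
  by rewrite -lerBrDr.
have tau_le : tau - ell <= tmax - e.
  rewrite lerBrDr; apply: le_trans taut.
  by rewrite -[j.+1%:R]natr1 /e le_eqVlt; apply/orP; left; apply/eqP; ring.
etransitivity; first exact: (gauss_dilate2 mG G0 cH H0 GH Kd Kcv tau_le).
have -> : (k%:R - j.+1%:R) * ell = e - ell by rewrite /e -[j.+1%:R]natr1; ring.
rewrite opprB expRD lnK ?posrE// -!mulrA; congr (_ * (_ * (_ * (_ * W _ _))))%:E.
by rewrite addrAC addrA.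
Unshelve. all: by end_near. Qed.

Lemma gauss_dilate_double tau : tau <= tmax ->
  gauss_dilate s k.*2 F tau = (W k tau)%:E.
Proof.
by move=> h; rewrite step// subrr mul0r ?addr0// oppr0 expR0 mul1r.
Qed.

End gauss_dilate_double.

(** * Energies in the pressure class *)

Section convex_on_halfline.
Context {R : realType} (U : R -> R).
Hypothesis U0 : U 0 = 0.
Hypothesis U_conv : convex_function `[(0 : R), +oo[%classic U.

Lemma convex_chord a b c : 0 <= a -> a <= b -> b <= c -> a < c ->
  (c - a) * U b <= (c - b) * U a + (b - a) * U c.
Proof.
move=> a0 ab bc ac; have ca : 0 < c - a by rewrite subr_gt0.
have t0 : 0 <= (c - b) / (c - a) by rewrite divr_ge0 ?subr_ge0// ltW.
have t1 : (c - b) / (c - a) <= 1 by rewrite ler_pdivrMr// mul1r lerD2l lerN2.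
set t := (c - b) / (c - a) in t0 t1.
have : U (t * a + (1 - t) * c) <= t * U a + (1 - t) * U c.
  have := @U_conv (Itv01 t0 t1) a c.
  by rewrite !inE/= !in_itv/= a0 (le_trans a0 (ltW ac)) => /(_ isT isT).
have -> : t * a + (1 - t) * c = b by rewrite /t; field; rewrite gt_eqF.
have -> : 1 - t = (b - a) / (c - a) by rewrite /t; field; rewrite gt_eqF.
rewrite /t.
rewrite -(ler_pM2l ca) => /le_trans; apply.
by rewrite le_eqVlt; apply/orP; left; apply/eqP; field; rewrite gt_eqF.
Qed.

(** Convexity on the chord from the origin, where U vanishes. *)
Lemma convex_ratio_ndecr r t : 0 < r -> r <= t -> U r / r <= U t / t.
Proof.
move=> r0 rt; have t0 := lt_le_trans r0 rt.
rewrite ler_pdivrMr// mulrAC ler_pdivlMr//.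
have := convex_chord (lexx 0) (ltW r0) rt t0.
by rewrite !subr0 U0 mulr0 add0r mulrC [r * _]mulrC.
Qed.

Lemma convex_slope_ndecr r h k : 0 <= r -> 0 < h -> h <= k ->
  h^-1 * (U (r + h) - U r) <= k^-1 * (U (r + k) - U r).
Proof.
move=> r0 h0 hk; have k0 := lt_le_trans h0 hk.
rewrite ler_pdivrMl// mulrCA ler_pdivlMl//.
have := @convex_chord r (r + h) (r + k) r0.
rewrite lerDl lerD2l ltrDl => /(_ (ltW h0) hk k0).
have -> : r + k - r = k by lra.
have -> : r + k - (r + h) = k - h by lra.
have -> : r + h - r = h by lra.
nra.
Qed.

Lemma convex_slope_ge r h : 0 < r -> 0 < h ->
  (r / 2)^-1 * (U r - U (r / 2)) <= h^-1 * (U (r + h) - U r).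
Proof.
move=> r0 h0; have r2 : 0 < r / 2 by rewrite divr_gt0.
rewrite ler_pdivrMl// mulrCA ler_pdivlMl//.
have := @convex_chord (r / 2) r (r + h) (ltW r2).
have e1 : r / 2 <= r by lra.
have e2 : r / 2 < r + h by lra.
rewrite lerDl => /(_ e1 (ltW h0) e2).
have -> : r + h - r / 2 = r / 2 + h by lra.
have -> : r + h - r = h by lra.
have -> : r - r / 2 = r / 2 by lra.
nra.
Qed.

(** The slopes decrease as h decreases to 0 and are bounded below by the slope over [r/2, r], an
    interval available because r > 0. *)
Lemma convex_right_derive r : 0 < r ->
  h^-1 * (U (r + h) - U r) @[h --> 0^'+] --> right_derive U r.
Proof.
move=> r0; apply: nondecreasing_at_right_is_cvgr.
  near=> x => h k; rewrite !in_itv/= => /andP[h0 _] /andP[k0 _] hk.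
  by apply: convex_slope_ndecr => //; exact: ltW.
near=> x; exists ((r / 2)^-1 * (U r - U (r / 2))) => _ [h /= + <-].
by rewrite in_itv/= => /andP[h0 hx]; exact: convex_slope_ge.
Unshelve. all: by end_near. Qed.

(** On (r/2, 2r) the chords over [r/2, r] and [r, 2r] enclose the graph; the sum L of their absolute
    slopes is a Lipschitz constant at r in every case. *)
Lemma convex_continuous r : 0 < r -> {for r, continuous U}.
Proof.
move=> r0; have r2 : 0 < r / 2 by rewrite divr_gt0.
pose L := `|U (r + r) - U r| / r + `|U r - U (r / 2)| / (r / 2).
have L0 : 0 <= L by rewrite addr_ge0// divr_ge0// ltW.
have lip t : r / 2 < t < r + r -> `|U t - U r| <= L * `|t - r|.
  move=> /andP[t1 t2].
  have A0 := normr_ge0 (U (r + r) - U r); have A1 := ler_norm (U (r + r) - U r).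
  have B0 := normr_ge0 (U r - U (r / 2)); have B1 := ler_norm (U r - U (r / 2)).
  have A2 := ler_norm (- (U (r + r) - U r)); rewrite normrN in A2.
  have B2 := ler_norm (- (U r - U (r / 2))); rewrite normrN in B2.
  set A := `|U (r + r) - U r| in A0 A1 A2 L L0 *.
  set B := `|U r - U (r / 2)| in B0 B1 B2 L L0 *.
  have [rt|tr] := leP r t.
    rewrite [X in _ * X]ger0_norm ?subr_ge0//.
    have c1 := @convex_chord r t (r + r) (ltW r0) rt (ltW t2) (ltac:(lra)).
    have c2 := @convex_chord (r / 2) r t (ltW r2) (ltac:(lra)) rt t1.
    rewrite ler_norml; apply/andP; split.
      rewrite lerNl opprB (@le_trans _ _ (B / (r / 2) * (t - r)))//.
        rewrite mulrAC ler_pdivlMr//.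
        by nra.
      by rewrite ler_wpM2r ?subr_ge0// lerDr divr_ge0// ltW.
    rewrite (@le_trans _ _ (A / r * (t - r)))//.
      by rewrite mulrAC ler_pdivlMr//; nra.
    by rewrite ler_wpM2r ?subr_ge0// lerDl divr_ge0// ltW.
  rewrite [X in _ * X]ltr0_norm ?subr_lt0// opprB.
  have c1 := @convex_chord t r (r + r) (ltac:(lra)) (ltW tr) (ltac:(lra)) t2.
  have c2 := @convex_chord (r / 2) t r (ltW r2) (ltW t1) (ltW tr) (ltac:(lra)).
  rewrite ler_norml; apply/andP; split.
    rewrite lerNl opprB (@le_trans _ _ (A / r * (r - t)))//.
      by rewrite mulrAC ler_pdivlMr//; nra.
    by rewrite ler_wpM2r ?subr_ge0 ?(ltW tr)// lerDl divr_ge0// ltW.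
  rewrite (@le_trans _ _ (B / (r / 2) * (r - t)))//.
    by rewrite mulrAC ler_pdivlMr//; nra.
  by rewrite ler_wpM2r ?subr_ge0 ?(ltW tr)// lerDr divr_ge0// ltW.
apply/cvgrPdist_lt => e e0; near=> t.
have tI : r / 2 < t < r + r.
  apply/andP; split; near: t; [apply: lt_nbhsr|apply: lt_nbhsl]; lra.
rewrite distrC (le_lt_trans (lip t tI))//.
have td : `|t - r| < e / (L + 1).
  have eL : 0 < e / (L + 1) by rewrite divr_gt0// ltr_wpDl.
  rewrite ltr_distl; apply/andP; split; near: t; [apply: lt_nbhsr|apply: lt_nbhsl].
    by rewrite ltrBlDr ltrDl divr_gt0// ltr_wpDl.
  by rewrite ltrDl divr_gt0// ltr_wpDl.
rewrite (@le_lt_trans _ _ ((L + 1) * `|t - r|))//.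
  by rewrite ler_wpM2r// lerDl.
by rewrite mulrC -ltr_pdivlMr// ltr_wpDl.
Unshelve. all: by end_near. Qed.

End convex_on_halfline.

(** * Finite differences and one-sided derivatives in the variable ln r *)

Section finite_difference.
Context {R : realType}.
Implicit Types (F : R -> R) (h t : R).

Definition fdiff h F t : R := F (t + h) - F t.

Definition fdiffn h k F : R -> R := iter k (fdiff h) F.

Lemma fdiffnS h k F t : fdiffn h k.+1 F t = fdiffn h k F (t + h) - fdiffn h k F t.
Proof. by []. Qed.

Lemma continuous_fdiffn h k F : continuous F -> continuous (fdiffn h k F).
Proof.
move=> cF; elim: k => [//|k IH] t; apply: cvgB; last exact: IH.
have ca : {for t, continuous (fun t : R => t + h)}.
  by apply: cvgD; [exact: cvg_id|exact: cvg_cst].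
exact: (continuous_comp ca (@IH _)).
Qed.

Lemma is_derive_fdiffn h k F dF : (forall t : R, is_derive t 1 F (dF t)) ->
  forall t : R, is_derive t 1 (fdiffn h k F) (fdiffn h k dF t).
Proof.
move=> Fd; elim: k => [//|k IH] t.
have sd : is_derive t 1 (fun t => t + h) 1.
  by apply: (is_derive_eq (is_derive1D (is_derive_id t 1) (is_derive1_cst t h))); rewrite addr0.
have := is_derive1_compl (f := fdiffn h k F) (g := fun t => t + h) (IH (t + h)) sd.
by rewrite mul1r => IHs; exact: (is_derive1B IHs (IH t)).
Qed.

Lemma fdiffn_cvgNy h k F : F t @[t --> -oo] --> (0 : R) ->
  fdiffn h k F t @[t --> -oo] --> (0 : R).
Proof.
move=> F0; elim: k => [//|k IH].
rewrite -[X in _ --> X](subr0 0); apply: cvgB => //.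
have sh : t + h @[t --> -oo] --> -oo.
  apply/cvgrNyPle => A; near=> t.
  have tA : t <= A - h by near: t; apply: nbhs_ninfty_le; exact: num_real.
  by rewrite -lerBrDr.
exact: (cvg_comp _ _ sh IH).
Unshelve. all: by end_near. Qed.

Lemma fdiffnD h F G k t :
  fdiffn h k (fun t => F t + G t) t = fdiffn h k F t + fdiffn h k G t.
Proof. by elim: k t => [//|k IH] t; rewrite !fdiffnS !IH; ring. Qed.

Lemma fdiffnZ h F k (c : R) t :
  fdiffn h k (fun t => c * F t) t = c * fdiffn h k F t.
Proof. by elim: k t => [//|k IH] t; rewrite !fdiffnS !IH; ring. Qed.

Lemma fdiffn_expR h k t : fdiffn h k expR t = (expR h - 1) ^+ k * expR t.
Proof.
by elim: k t => [|k IH] t; rewrite ?expr0 ?mul1r// fdiffnS !IH exprS expRD; ring.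
Qed.

Lemma fdiffn_add h j k F : fdiffn h (j + k) F = fdiffn h j (fdiffn h k F).
Proof. exact: iterD. Qed.

Section tower.
Variable Phi : nat -> R -> R.
Hypothesis Phi_derive : forall j (t : R), is_derive t 1 (Phi j.+1) (Phi j t).

(** The mean value theorem k times: each use descends one level of the tower and releases one factor
    h. *)
Lemma fdiffn_mean h k t : 0 <= h ->
  exists2 x, t <= x <= t + k%:R * h & fdiffn h k (Phi k) t = h ^+ k * Phi 0 x.
Proof.
move=> h0; elim: k t => [|k IH] t.
  by exists t; rewrite ?mul0r ?addr0 ?lexx// expr0 mul1r.
have th : t <= t + h by rewrite lerDl.
have [|y] := MVT_segment th (fun u _ => is_derive_fdiffn h k (Phi_derive k) u).
  apply: continuous_subspaceT => u.
  exact: (is_derive1_continuous (is_derive_fdiffn h k (Phi_derive k) u)).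
rewrite in_itv/= => /andP[ty yt] E.
have [x /andP[yx xy] Ex] := IH y; exists x.
  rewrite (le_trans ty yx)/= -natr1 mulrDl mul1r.
  by move: xy yt; set kh := k%:R * h; lra.
by rewrite /fdiff E Ex exprS; ring.
Qed.

(** By [fdiffn_mean], j of the k differences turn [Phi j] into h^j times a value of [Phi 0]; the
    other k - j preserve the limit 0. The primitives themselves need not vanish at -oo. *)
Lemma fdiffn_tower_cvgNy h j k : 0 <= h -> (j <= k)%N ->
  Phi 0 t @[t --> -oo] --> (0 : R) ->
  fdiffn h k (Phi j) t @[t --> -oo] --> (0 : R).
Proof.
move=> h0 jk P0; rewrite -(subnK jk) fdiffn_add; apply: fdiffn_cvgNy.
apply/cvgrPdist_le => e e0.
have e1 : 0 < e / (h ^+ j + 1) by rewrite divr_gt0// ltr_wpDl// exprn_ge0.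
move/cvgrPdist_le : P0 => /(_ _ e1) [A [Ar HA]]; near=> t.
have tA : t < A - j%:R * h by near: t; apply: nbhs_ninfty_lt; exact: num_real.
have [x /andP[tx xt] ->] := fdiffn_mean j t h0.
have := HA x; rewrite ltrBrDr in tA => /(_ (le_lt_trans xt tA)).
rewrite !sub0r !normrN normrM (ger0_norm (exprn_ge0 _ h0)) => Hx.
rewrite (@le_trans _ _ (h ^+ j * (e / (h ^+ j + 1))))// ?ler_wpM2l ?exprn_ge0//.
rewrite mulrCA ger_pMr// ler_pdivrMr ?mul1r ?lerDl//.
by rewrite ltr_wpDl// exprn_ge0.
Unshelve. all: by end_near. Qed.

End tower.

(** In the variable ln r a dilation by e^h is a translation by h. *)
Lemma foldr_Delta_nseq h k (F : R -> R) t :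
  foldr Delta F (nseq k (expR h)) (expR t) = fdiffn h k (F \o expR) t.
Proof.
elim: k t => [//|k IH] t.
by rewrite fdiffnS -!IH /= {1}/Delta mulrC -expRD.
Qed.

End finite_difference.

Section right_derivative.
Context {R : realType}.
Implicit Types (F G : R -> R) (t d : R).

Definition is_rderive F t d : Prop :=
  (F (t + e) - F t) / e @[e --> 0^'+] --> d.

Lemma is_rderiveB F G t d d' : is_rderive F t d -> is_rderive G t d' ->
  is_rderive (fun t => F t - G t) t (d - d').
Proof.
move=> Fd Gd; apply: (cvg_trans _ (cvgB Fd Gd)).
by apply: near_eq_cvg; near=> e => /=; rewrite !fctE; ring.
Unshelve. all: by end_near. Qed.

Lemma is_rderive_fdiffn h k F dF : (forall t, is_rderive F t (dF t)) ->
  forall t, is_rderive (fdiffn h k F) t (fdiffn h k dF t).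
Proof.
move=> Fd; elim: k => [//|k IH] t.
have IHs : is_rderive (fun t => fdiffn h k F (t + h)) t (fdiffn h k dF (t + h)).
  rewrite /is_rderive (_ : (fun e => _) =
    (fun e => (fdiffn h k F (t + h + e) - fdiffn h k F (t + h)) / e)).
    exact: IH.
  by apply/funext => e; rewrite addrAC.
exact: (is_rderiveB IHs (IH t)).
Qed.

Lemma is_rderiveM F G t d d' : {for t, continuous F} ->
  is_rderive F t d -> is_rderive G t d' ->
  is_rderive (fun t => F t * G t) t (F t * d' + d * G t).
Proof.
move=> cF Fd Gd.
have cFt : F (t + e) @[e --> 0^'+] --> F t.
  have h : t + e @[e --> 0^'+] --> t.
    have := @cvg_at_right_filter _ _ (fun e : R => t + e) 0 (t + 0).
    rewrite addr0; apply.
    by rewrite -[X in _ --> X]addr0; apply: cvgD; [exact: cvg_cst|exact: cvg_id].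
  exact: (cvg_comp _ _ h cF).
have h1 : F (t + e) * ((G (t + e) - G t) / e) @[e --> 0^'+] --> F t * d'.
  by apply: cvgM; [exact: cFt|exact: Gd].
have h2 : (F (t + e) - F t) / e * G t @[e --> 0^'+] --> d * G t.
  by apply: cvgMr_tmp; exact: Fd.
apply: (cvg_trans _ (cvgD h1 h2)).
by apply: near_eq_cvg; near=> e => /=; rewrite !fctE; ring.
Unshelve. all: by end_near. Qed.

Lemma is_derive_is_rderive F t d : is_derive t 1 F d -> is_rderive F t d.
Proof.
move=> [Fd Fe]; move: Fd; rewrite /derivable => /cvg_ex[l hl].
have E : d = l.
  by rewrite -Fe /derive; apply/cvg_lim => //.
rewrite E /is_rderive; apply: (cvg_trans _ (cvg_dnbhs_at_right hl)).
apply: near_eq_cvg; near=> e => /=.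
by rewrite [_%:A]mulr1 [t + e]addrC mulrC.
Unshelve. all: by end_near. Qed.

(* The supremum of the points of [a, b] where F + e.id is at least its value at
   a is attained by continuity, and it cannot be < b since the right derivative
   of F + e.id is positive there. *)
Lemma rderive_ge0_ndecr F : continuous F ->
  (forall t, exists2 d, 0 <= d & is_rderive F t d) ->
  forall a b, a <= b -> F a <= F b.
Proof.
move=> cF Fd a b ab; apply/ler_addgt0Pr => e e0.
(* Tilting F by c t makes its right derivative strictly positive at a total cost c (b - a) <= e; the
   1 keeps c well defined when a = b. *)
pose c := e / (b - a + 1).
have ba1 : 0 < b - a + 1 by rewrite ltr_wpDl// subr_ge0.
have c0 : 0 < c by rewrite divr_gt0.
pose G t := F t + c * t.
have cG : continuous G.
  move=> t; apply: cvgD; first exact: cF.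
  by apply: cvgMl_tmp; exact: cvg_id.
suff : G a <= G b.
  have : c * (b - a) <= e.
    by rewrite /c mulrAC ler_pdivrMr// ler_wpM2l ?(ltW e0)// lerDl.
  rewrite /G; lra.
pose S := [set t | a <= t <= b /\ G a <= G t].
have Sa : S a by split => //; rewrite lexx.
have Sub : ubound S b by move=> t [/andP[]].
have supS : has_sup S by split; [exists a|exists b].
pose z := sup S.
have az : a <= z by apply: ub_le_sup => //; exists b.
have zb : z <= b by apply: ge_sup => //; exists a.
have Gz : G a <= G z.
  rewrite leNgt; apply/negP => Gza.
  have Gaz : 0 < G a - G z by rewrite subr_gt0.
  have /cvgrPdist_lt/(_ _ Gaz)/nbhs_ballP[d /= d0 dP] := @cG z.
  have [t St zt] := sup_adherent d0 supS.
  have tz : t <= z by apply: ub_le_sup => //; exists b.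
  have : G t < G a.
    have : `|G z - G t| < G a - G z.
      by apply: dP; rewrite /ball/= ger0_norm ?subr_ge0// ltrBlDr addrC -ltrBlDr.
    by rewrite ltr_norml; lra.
  by rewrite ltNge; case: St => _ ->.
have [->//|zNb] := eqVneq b z; have {}zb : z < b by rewrite lt_neqAle eq_sym zNb.
exfalso; have [d d0 dz] := Fd z.
have Gd : is_rderive G z (d + c).
  apply: (cvg_trans _ (cvgD dz (cvg_cst c))).
  apply: near_eq_cvg; near=> u => /=; rewrite !fctE /G.
  have u0 : u != 0 by rewrite gt_eqF//; near: u; exact: nbhs_right_gt.
  by field.
have dc : 0 < d + c by rewrite ltr_wpDl.
have /cvgrPdist_lt/(_ _ dc) nG := Gd.
near (0 : R)^'+ => u.
have u0 : 0 < u by near: u; exact: nbhs_right_gt.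
have uzb : u < b - z by near: u; apply: nbhs_right_lt; rewrite subr_gt0.
have : 0 < (G (z + u) - G z) / u.
  have : `|d + c - (G (z + u) - G z) / u| < d + c by near: u.
  by rewrite ltr_norml; lra.
rewrite pmulr_lgt0 ?invr_gt0// subr_gt0 => Gu.
have : S (z + u).
  split; last by rewrite (le_trans Gz)// ltW.
  by rewrite (le_trans az) ?lerDl ?(ltW u0)//= -lerBrDl ltW.
move=> /(ub_le_sup (ex_intro _ b Sub)); rewrite -/z.
by rewrite gerDl leNgt u0.
Unshelve. all: by end_near. Qed.

End right_derivative.

Section pressure_class.
Context {R : realType} (U : R -> R) (k : nat).
Hypothesis UPC : pressure_class k U.

Let U0 : U 0 = 0. Proof. by case: UPC => [[]]. Qed.
Let U_conv : convex_function `[(0 : R), +oo[%classic U. Proof. by case: UPC. Qed.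

Let f (t : R) := U (expR t).

Lemma continuous_energy_exp : continuous f.
Proof.
move=> t; apply: (continuous_comp (@continuous_expR _ t)).
exact: (convex_continuous U_conv (expR_gt0 t)).
Qed.

Lemma energy_ratio_ndecr t u : t <= u -> expR (- t) * f t <= expR (- u) * f u.
Proof.
move=> tu; rewrite !expRN mulrC [leRHS]mulrC.
by apply: (convex_ratio_ndecr U0 U_conv); rewrite ?expR_gt0// ler_expR.
Qed.

(** By definition of the pressure, the claimed value is e^t U'_+(e^t), the chain rule applied to U o
    exp. *)
Lemma is_rderive_energy_exp t : is_rderive f t (pressure U (expR t) + f t).
Proof.
have r0 := expR_gt0 t.
rewrite /pressure gt_eqF// subrK.
pose F (e : R) := expR (t + e) - expR t.
have F0 : F 0 = 0 by rewrite /F addr0 subrr.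
have cF : continuous F.
  move=> e; apply: cvgB; last exact: cvg_cst.
  have ce : {for e, continuous (fun e : R => t + e)}.
    by apply: cvgD; [exact: cvg_cst|exact: cvg_id].
  exact: (continuous_comp ce (@continuous_expR _ _)).
have q : (F e)^-1 * (U (expR t + F e) - U (expR t)) @[e --> 0^'+] --> right_derive U (expR t).
  (* The increment F of exp is increasing and vanishes at 0, so it tends to 0 from the right, as the
     right derivative of U requires. *)
  apply: (@increasing_cvg_at_right_comp _ F
    (fun h => h^-1 * (U (expR t + h) - U (expR t))) 0 (BInfty _ false)).
  - by [].
  - by move=> x y _ _ xy; rewrite /F ltrD2r ltr_expR ltrD2l.
  - by apply: cvg_at_right_filter; exact: cF.
  - by rewrite F0; exact: (convex_right_derive U_conv r0).
have e' : F e / e @[e --> 0^'+] --> expR t := is_derive_is_rderive (is_derive_expR t).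
have h : (F e / e) * ((F e)^-1 * (U (expR t + F e) - U (expR t))) @[e --> 0^'+]
    --> expR t * right_derive U (expR t) by apply: cvgM; [exact: e'|exact: q].
apply: (cvg_trans _ h); apply: near_eq_cvg; near=> e.
have e0 : 0 < e by near: e; exact: nbhs_right_gt.
have Fe : 0 < F e by rewrite /F subr_gt0 ltr_expR ltrDl.
have -> : expR t + F e = expR (t + e) by rewrite /F addrCA subrr addr0.
by rewrite /f; field; rewrite !gt_eqF.
Unshelve. all: by end_near. Qed.

(* The right derivative in t of e^-t D_h^k (U o exp) is e^-t D_h^k (P o exp). *)
Lemma twisted_fdiffn_ndecr h t u : 0 <= h -> t <= u ->
  expR (- t) * fdiffn h k f t <= expR (- u) * fdiffn h k f u.
Proof.
move=> h0 tu; suff : {homo (fun t => expR (- t) * fdiffn h k f t) : x y / x <= y} by exact.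
move=> {tu t u}; apply: rderive_ge0_ndecr.
  have cN : continuous (fun t : R => expR (- t)).
    move=> t; apply: continuous_cvg; first exact: continuous_expR.
    exact: continuousN.
  move=> t; apply: cvgM; first exact: cN.
  by apply: continuous_fdiffn; exact: continuous_energy_exp.
move=> t; exists (expR (- t) * fdiffn h k (pressure U \o expR) t).
  rewrite mulr_ge0 ?expR_ge0// -foldr_Delta_nseq.
  have [_ _ /(_ (nseq_tuple k (expR h)))] := UPC; apply; last exact: expR_ge0.
  by apply/allP => x /nseqP[-> _]; rewrite -expR0 ler_expR.
have Nd : is_derive t 1 (fun t : R => expR (- t)) (- expR (- t)).
  have Nid : is_derive t 1 (fun t : R => - t) (-1).
    exact: is_deriveNid.
  apply: (is_derive_eq (@is_derive1_compl _ expR (fun t => - t) t _ _ (is_derive_expR _) Nid)).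
  by rewrite mulN1r.
have := is_rderiveM (is_derive1_continuous Nd) (is_derive_is_rderive Nd)
  (@is_rderive_fdiffn _ h k f _ is_rderive_energy_exp t).
rewrite (_ : fdiffn h k _ t = fdiffn h k (pressure U \o expR) t + fdiffn h k f t); last first.
  exact: (fdiffnD h (pressure U \o expR) f k t).
by rewrite mulrDr mulNr addrK.
Qed.

(** Convexity with U 0 = 0 allows a downward jump at 0 but no upward one. If U is not eventually
    above -e, a chord from a point r' where U(r') < -e to 1 keeps U below -e/2 near 0. *)
Lemma energy_at0 : f t @[t --> -oo] --> (0 : R) \/
  exists2 delta, 0 < delta & exists t0, forall t, t <= t0 -> f t <= - delta.
Proof.
have [|] := pselect (f t @[t --> -oo] --> (0 : R)); first by left.
move=> nf; right; apply: contrapT => nd; apply: nf.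
apply/cvgrPdist_le => e e0.
have ub : \forall t \near -oo, f t <= e.
  near=> t.
  have t0 : t <= 0 by near: t; apply: nbhs_ninfty_le; exact: num_real.
  have te : t <= ln (e / (`|f 0| + 1)).
    by near: t; apply: nbhs_ninfty_le; exact: num_real.
  have := energy_ratio_ndecr t0; rewrite oppr0 expR0 mul1r expRN ler_pdivrMl ?expR_gt0//.
  move=> /le_trans; apply; rewrite (@le_trans _ _ (expR t * (`|f 0| + 1)))//.
    by rewrite ler_wpM2l ?expR_ge0// (le_trans (ler_norm _))// lerDl.
  rewrite -ler_pdivlMr ?ltr_wpDl//.
  by rewrite -[leRHS]lnK ?posrE ?divr_gt0 ?ltr_wpDl// ler_expR.
have lb : \forall t \near -oo, - e <= f t.
  apply: contrapT => nlb; apply: nd; exists (e / 2); first by rewrite divr_gt0.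
  (* For r' < r the chord from r' to 1 gives roughly U(r) <= -e + r M, which is at most -e/2 once r
     <= e/(2M). *)
  pose M := e + `|U 1|.
  have M0 : 0 < M by rewrite ltr_pwDl.
  exists (Num.min (ln (e / (2 * M))) (ln 2^-1)) => t.
  rewrite le_min => /andP[t1 t2].
  have r1 : expR t <= e / (2 * M).
    by rewrite -[leRHS]lnK ?posrE ?divr_gt0 ?mulr_gt0// ler_expR.
  have r2 : expR t <= 2^-1 by rewrite -[leRHS]lnK ?posrE// ler_expR.
  have [u ut fu] : exists2 u, u < t & f u < - e.
    apply: contrapT => nu; apply: nlb; near=> u.
    rewrite leNgt; apply/negP => fu; apply: nu; exists u => //.
    by near: u; apply: nbhs_ninfty_lt; exact: num_real.
  have ur : expR u < expR t by rewrite ltr_expR.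
  have u0 := expR_gt0 u.
  have := convex_chord U_conv (ltW u0) (ltW ur) (ltac:(lra) : expR t <= 1) (ltac:(lra)).
  have U1 := ler_norm (U 1); have U1' := normr_ge0 (U 1).
  have rM : expR t * M <= e / 2.
    move: r1; rewrite invfM mulrA -ler_pdivrMr ?invrK ?invr_gt0//.
  rewrite -/(f t) -/(f u) => ch; rewrite leNgt; apply/negP => ft.
  move: ch rM fu ft; rewrite /M; set r := expR t in r1 r2 ur *; set r' := expR u in u0 ur *.
  nra.
near=> t; rewrite sub0r normrN ler_norml.
by apply/andP; split; near: t.
Unshelve. all: by end_near. Qed.

End pressure_class.

(** * Contraction for k-th differences, and integrals of the energy *)

Section finite_difference_contraction.
Context {R : realType} (s : R) (s_gt0 : 0 < s) (n k : nat) (n_le : (n <= k.*2)%N).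
Variables (mu : probability 'rV[R]_n R).

(** The peak of the log-Gaussian, an upper bound for the logarithm of every density of this form. *)
Definition lmax : R := lgauss s (0 : 'rV[R]_n).

Lemma ln_density_le (X : 'rV[R]_n -> 'rV[R]_n) x : measurable_fun setT X ->
  ln (density s mu X x) <= lmax.
Proof.
move=> mX; rewrite -ler_expR lnK ?posrE ?density_gt0//.
exact: density_le.
Qed.

Lemma measurable_ln_density (X : 'rV[R]_n -> 'rV[R]_n) : measurable_fun setT X ->
  measurable_fun setT (fun x => ln (density s mu X x)).
Proof. by move=> mX; apply: measurableT_comp => //; exact: measurable_density. Qed.

Lemma measurable_comp_ln_density (v : R -> R) (X : 'rV[R]_n -> 'rV[R]_n) :
  continuous v -> measurable_fun setT X ->
  measurable_fun setT (fun x => v (ln (density s mu X x))).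
Proof.
move=> cv mX.
exact: (measurableT_comp (continuous_measurable_fun cv) (measurable_ln_density mX)).
Qed.

Lemma cvg_expR_Ny : (expR : R -> R) t @[t --> -oo] --> (0 : R).
Proof.
apply/cvgNy_compNP => /=; exact: cvgr_expR.
Qed.

Variables (T : 'rV[R]_n -> 'rV[R]_n) (T_lip : lipschitz1 T).
Variables (h : R) (Phi : nat -> R -> R).
Hypothesis h_ge0 : 0 <= h.
Hypothesis Phi_derive : forall j (t : R), is_derive t 1 (Phi j.+1) (Phi j t).
Hypothesis Phi0_cont : continuous (Phi 0).
Hypothesis Phi0_cvg : Phi 0 t @[t --> -oo] --> (0 : R).
Hypothesis Phi0_nincr : forall t u, t <= u ->
  expR (- u) * fdiffn h k (Phi 0) u <= expR (- t) * fdiffn h k (Phi 0) t.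
Hypothesis Phik_ge0 : forall t, t <= lmax -> 0 <= fdiffn h k (Phi k) t.

Let Phi_cont j : continuous (Phi j).
Proof.
by case: j => [//|j] t; exact: (is_derive1_continuous (Phi_derive j t)).
Qed.

Theorem fdiffn_contraction :
  (\int[lebesgue_rV n]_x (fdiffn h k (Phi k) (ln (density s mu T x)))%:E <=
   \int[lebesgue_rV n]_x (fdiffn h k (Phi k) (ln (density s mu id x)))%:E)%E.
Proof.
pose ell : R := ln (2 * pi * s).
pose chi t := expR (- t) * fdiffn h k (Phi 0) t.
have cchi : continuous chi.
  have cN : continuous (fun t : R => expR (- t)).
    move=> t; apply: continuous_cvg; first exact: continuous_expR.
    exact: continuousN.
  by move=> t; apply: cvgM; [exact: cN|exact: continuous_fdiffn].
(* [chi] is nonincreasing, so on (-oo, lmax] it is least at [lmax]. The resulting term b e^t adds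
   the same constant b to both integrals, which cancels at the end. *)
pose b := Num.max 0 (- chi lmax).
have b0 : 0 <= b by rewrite le_max lexx.
have chib t : t <= lmax -> 0 <= b + chi t.
  move=> tl; rewrite -lerBlDr sub0r /b le_max.
  by rewrite lerN2; apply/orP; right; exact: Phi0_nincr.
(* The maximum can act only where the shifted argument exceeds [lmax]; the shift anticipates the k
   pairs of Gaussian coordinates to be integrated out. *)
pose eta t := Num.max 0 (b + chi (t + k%:R * ell)).
have ceta : continuous eta.
  have c1 : continuous (fun t => b + chi (t + k%:R * ell)).
    move=> t; apply: cvgD; first exact: cvg_cst.
    have ca : {for t, continuous (fun t : R => t + k%:R * ell)}.
      by apply: cvgD; [exact: cvg_id|exact: cvg_cst].
    exact: (continuous_comp ca (@cchi _)).
  move=> t; have hm : {for t, continuous ((cst 0 : R -> R) \max (fun t => b + chi (t + k%:R * ell)))}.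
    by apply: continuous_max; [exact: cst_continuous|exact: c1].
  exact: hm.
have eta0 t : 0 <= eta t by rewrite /eta le_max lexx.
have eta_ni t u : t <= u -> eta u <= eta t.
  move=> tu; rewrite /eta ge_max !le_max lexx/=; apply/orP; right.
  by rewrite lerD2l; apply: Phi0_nincr; rewrite lerD2r.
pose F (t : R) : \bar R := (expR t * eta t)%:E.
have mF : measurable_fun setT F.
  apply/measurable_EFinP; apply: measurable_funM => //.
  exact: continuous_measurable_fun.
have F0 t : (0 <= F t)%E by rewrite lee_fin mulr_ge0 ?expR_ge0.
pose W j t := b * expR t + fdiffn h k (Phi j) t.
have W0c : continuous (W 0).
  move=> t; apply: cvgD; last exact: continuous_fdiffn.
  by apply: cvgMl_tmp; exact: continuous_expR.
have Wd j (t : R) : (j < k)%N -> is_derive t 1 (W j.+1) (W j t).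
  move=> _; apply: is_derive1D (is_derive1Z b (is_derive_expR t)) _.
  exact: (is_derive_fdiffn h k (Phi_derive j) t).
have Wcv j : (j < k)%N -> W j.+1 t @[t --> -oo] --> (0 : R).
  move=> jk; rewrite -[X in _ --> X](addr0 0) -[X in _ --> X + _](mulr0 b).
  apply: cvgD; first by apply: cvgMl_tmp; exact: cvg_expR_Ny.
  exact: (fdiffn_tower_cvgNy Phi_derive h_ge0 jk Phi0_cvg).
have FW t : t + k%:R * ell <= lmax ->
    F t = (expR (- (k%:R * ell)) * W 0 (t + k%:R * ell))%:E.
  move=> tl; rewrite /F /eta max_r ?chib// /W /chi; congr EFin.
  rewrite mulrDr mulrDr; congr (_ + _).
    by rewrite mulrC mulrCA -expRD addrCA addNr addr0.
  by rewrite mulrA -expRD opprD addrA subrr add0r.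
have GW (X : 'rV[R]_n -> 'rV[R]_n) : measurable_fun setT X ->
   (\int[lebesgue_rV n]_x gauss_dilate s (n + (k.*2 - n)) F (ln (density s mu X x)) =
    b%:E + \int[lebesgue_rV n]_x (fdiffn h k (Phi k) (ln (density s mu X x)))%:E)%E.
  (* With d = 2k - n the Gaussian coordinates number n + d = 2k, that is, k pairs. *)
  move=> mX; rewrite subnKC//.
  transitivity (\int[lebesgue_rV n]_x (b%:E * (density s mu X x)%:E +
     (fdiffn h k (Phi k) (ln (density s mu X x)))%:E))%E.
    apply: eq_integral => x _.
    rewrite (gauss_dilate_double s_gt0 mF F0 W0c Wd Wcv FW) ?ln_density_le//.
    by rewrite /W lnK ?posrE ?density_gt0.
  have mD : measurable_fun setT (fun x => fdiffn h k (Phi k) (ln (density s mu X x))).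
    by apply: measurable_comp_ln_density => //; exact: continuous_fdiffn.
  have md := measurable_density s_gt0 mu mX.
  rewrite ge0_integralD//.
  - by rewrite ge0_integralZl// ?integral_density ?mule1//;
      [exact/measurable_EFinP|move=> x _; rewrite lee_fin ltW// density_gt0].
  - by move=> x _; rewrite mule_ge0// lee_fin ltW// density_gt0.
  - by apply/measurable_EFinP; exact: measurable_funM.
  - by move=> x _; rewrite lee_fin Phik_ge0// ln_density_le.
  - exact/measurable_EFinP.
have := gauss_dilate_contraction s_gt0 (k.*2 - n) mu T_lip ceta eta0 eta_ni.
rewrite -/F [leLHS](GW _ (lipschitz1_measurable T_lip)) [leRHS](GW _ (@measurable_id _ _ _)).
by rewrite leeD2lE.
Qed.

End finite_difference_contraction.

Section energy_of_density.
Context {R : realType} (s : R) (s_gt0 : 0 < s) (n : nat).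
Variable mu : probability 'rV[R]_n R.
Variables (X : 'rV[R]_n -> 'rV[R]_n) (mX : measurable_fun setT X).
Variables (f : R -> R) (beta : R).
Let lrho x := ln (density s mu X x).
Let v (t : R) := beta * expR t - f t.
Hypothesis f_cont : continuous f.
Hypothesis v_ge0 : forall t, t <= lmax s n -> 0 <= v t.

Let rho_gt0 x := density_gt0 s_gt0 mu mX x.

Let v_cont : continuous v.
Proof.
move=> t; apply: cvgB; last exact: f_cont.
by apply: cvgMl_tmp; exact: continuous_expR.
Qed.

Let mv : measurable_fun setT (fun x => v (lrho x)).
Proof. exact: measurable_comp_ln_density. Qed.

Let mf : measurable_fun setT (fun x => f (lrho x)).
Proof. exact: measurable_comp_ln_density. Qed.

Let md := measurable_density s_gt0 mu mX.

Let vE x : v (lrho x) = beta * density s mu X x - f (lrho x).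
Proof. by rewrite /v lnK// posrE. Qed.

Let v0 x : 0 <= v (lrho x).
Proof. by apply: v_ge0; exact: ln_density_le. Qed.

Let rho_int c : (lebesgue_rV n).-integrable setT (fun x => (c * density s mu X x)%:E).
Proof.
under eq_fun do rewrite EFinM.
apply: integrableZl => //; apply/integrableP; split; first exact/measurable_EFinP.
under eq_integral do rewrite gee0_abs ?lee_fin ?(ltW (rho_gt0 _))//.
by rewrite integral_density// ltry.
Qed.

Let rho_intE c : (\int[lebesgue_rV n]_x (c * density s mu X x)%:E = c%:E)%E.
Proof.
under eq_integral do rewrite EFinM.
rewrite integralZl//.
  by rewrite integral_density// mule1.
have := rho_int 1; apply: eq_integrable => // x _; by rewrite mul1r.
Qed.

(** Subtraction is immediate when v(ln rho) is integrable. Otherwise f^+ still has integral at most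
    |beta|, because f <= beta e^t on the range of ln rho, so f^- must have infinite integral and
    both sides are -oo. *)
Lemma integral_energyE :
  (\int[lebesgue_rV n]_x (f (lrho x))%:E =
   beta%:E - \int[lebesgue_rV n]_x (v (lrho x))%:E)%E.
Proof.
have [Ioo|Ifin] := eqVneq (\int[lebesgue_rV n]_x (v (lrho x))%:E)%E +oo%E; last first.
  have vi : (lebesgue_rV n).-integrable setT (fun x => (v (lrho x))%:E).
    apply/integrableP; split; first exact/measurable_EFinP.
    under eq_integral do rewrite gee0_abs ?lee_fin ?v0//.
    by rewrite ltey.
  rewrite -[X in (X - _)%E](rho_intE beta) -integralB//.
  apply: eq_integral => x _; rewrite -EFinB; congr EFin.
  by rewrite vE opprB addrC subrK.
rewrite Ioo/= integralE.
set fp := (X in (X - _)%E); set fn := (X in (_ - X)%E).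
have fp_fin : (fp < +oo)%E.
  apply: (@le_lt_trans _ _ (`|beta|)%:E); last exact: ltry.
  rewrite -(rho_intE `|beta|); apply: ge0_le_integral => //.
  - by apply: measurable_funepos; exact/measurable_EFinP.
  - by apply/measurable_EFinP; exact: measurable_funM.
  move=> x _; rewrite funeposE ge_max !lee_fin mulr_ge0 ?(ltW (rho_gt0 x))// andbT.
  rewrite (@le_trans _ _ (beta * density s mu X x))//.
    by rewrite -subr_ge0 -vE.
  by rewrite ler_wpM2r ?ler_norm// ltW.
have fnE : fn = +oo%E.
  apply/eqP; rewrite -leye_eq -Ioo.
  have mfn : measurable_fun setT (fun x => (f (lrho x))%:E)^\-%E.
    by apply: measurable_funeneg; exact/measurable_EFinP.
  have h : (\int[lebesgue_rV n]_x (v (lrho x))%:E <= (`|beta|)%:E + fn)%E.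
    rewrite -(rho_intE `|beta|) -ge0_integralD//.
    - apply: ge0_le_integral => //.
      + by move=> x _; rewrite lee_fin.
      + exact/measurable_EFinP.
      + by apply: emeasurable_funD => //; apply/measurable_EFinP; exact: measurable_funM.
      move=> x _; rewrite vE EFinB leeD//.
        by rewrite lee_fin ler_wpM2r ?ler_norm// ltW.
      by rewrite funenegE le_max lexx.
    - by move=> x _; rewrite lee_fin mulr_ge0// ltW.
    - by apply/measurable_EFinP; exact: measurable_funM.
  move: h; rewrite Ioo leye_eq; case: fn => //=.
by rewrite fnE; move: fp_fin; case: fp.
Qed.

End energy_of_density.

Section convolution.
Context {R : realType} (s : R) (s_gt0 : 0 < s) (n : nat).
Variable mu : probability 'rV[R]_n R.

Lemma conv_gauss_density : conv_gauss mu s = density s mu id.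
Proof.
apply/funext => x; rewrite /conv_gauss /density; congr fine.
by apply: eq_integral => y _; rewrite gaussE.
Qed.

Lemma conv_gauss_pushforward (T : 'rV[R]_n -> 'rV[R]_n) : measurable_fun setT T ->
  conv_gauss (pushforward mu T) s = density s mu T.
Proof.
move=> mT; apply/funext => x; rewrite /conv_gauss /density; congr fine.
rewrite ge0_integral_pushforward//.
- by apply: eq_integral => y _; rewrite /= gaussE.
- under eq_fun do rewrite gaussE//.
  have h := @measurable_gauss_subr R s _ 'rV[R]_n n id x (@measurable_id _ 'rV[R]_n setT).
  by apply/measurable_EFinP; exact: h.
- by move=> y _; rewrite lee_fin gaussE// expR_ge0.
Qed.

(** The source of the value -oo when U(0+) < 0; on R^0 the measure is a unit mass, hence the
    condition on n. *)
Lemma lebesgue_rV_setT : (0 < n)%N -> lebesgue_rV n [set: 'rV[R]_n] = +oo%E.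
Proof.
move=> n0; have := @lebesgue_rV_box R n (fun=> setT) (fun=> measurableT).
rewrite (_ : [set v | _] = setT); last by apply/seteqP; split.
move=> ->; rewrite -(prednK n0).
elim: n.-1 => [|m IH]; first by rewrite big_ord1 -set_itvNyy lebesgue_measure_itv.
by rewrite big_ord_recl IH -set_itvNyy lebesgue_measure_itv.
Qed.

End convolution.

Theorem theorem1p3 (R : realType) (n : nat) (n_ge1 : (1 <= n)%N)
    (mu : probability 'rV[R]_n R) (T : 'rV[R]_n -> 'rV[R]_n)
    (T_lip : lipschitz1 T) (s : R) (s_gt0 : 0 < s)
    (k : nat) (k_ge : (uphalf n <= k)%N)
    (U : R -> R) (U_PCk : pressure_class k U) :
  (internal_energy U (conv_gauss mu s) <=
   internal_energy U (conv_gauss (pushforward mu T) s))%E.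
Proof.
have mT := lipschitz1_measurable T_lip.
have mI := @measurable_id _ 'rV[R]_n setT.
rewrite (conv_gauss_density s_gt0 mu) (conv_gauss_pushforward s_gt0 mu mT).
rewrite /internal_energy.
pose f t := U (expR t).
have fE X : measurable_fun setT X -> (\int[lebesgue_rV n]_x (U (density s mu X x))%:E =
    \int[lebesgue_rV n]_x (f (ln (density s mu X x)))%:E)%E.
  by move=> mX; apply: eq_integral => x _; rewrite /f lnK// posrE density_gt0.
rewrite [leLHS](fE _ mI) [leRHS](fE _ mT) {fE}.
have cf : continuous f := continuous_energy_exp U_PCk.
have ratio := energy_ratio_ndecr U_PCk.
(* U(r)/r is nondecreasing, so its value at the right end bounds it up to there. The end is lmax + k
   rather than lmax because mean value points of k differences of step at most 1 may lie k further
   to the right. *)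
pose beta := `|expR (- (lmax s n + k%:R)) * f (lmax s n + k%:R)|.
pose v t := beta * expR t - f t.
have cv : continuous v.
  move=> t; apply: cvgB; last exact: cf.
  by apply: cvgMl_tmp; exact: continuous_expR.
have v_ge0 t : t <= lmax s n + k%:R -> 0 <= v t.
  move=> /ratio h; rewrite subr_ge0 -ler_pdivrMr ?expR_gt0// mulrC -expRN.
  exact: (le_trans h (ler_norm _)).
have v_ge0' t : t <= lmax s n -> 0 <= v t.
  by move=> h; rewrite v_ge0// (le_trans h)// lerDl.
have EI := integral_energyE s_gt0 mu mI cf v_ge0'.
have ET := integral_energyE s_gt0 mu mT cf v_ge0'.
(* The sides change places: it remains to bound the integral for T by the one for mu, both of
   nonnegative functions. *)
rewrite [leLHS]EI [leRHS]ET {EI ET}; apply: leeD2l; rewrite leeN2.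
have [f0|[delta d0 [t0 ft0]]] := energy_at0 U_PCk; last first.
  (* If U(0+) < 0, the left-hand side is -oo, since rho < e^t0 outside a set of
     finite measure. *)
  suff E : (\int[lebesgue_rV n]_x (v (ln (density s mu id x)))%:E = +oo)%E.
    by rewrite [leRHS]E; exact: leey.
  (* This makes v(ln rho) + c rho >= delta everywhere: -f >= delta where ln rho <= t0, and c rho >=
     delta elsewhere. Since rho has mass 1, the second term contributes only c. *)
  pose c := delta * expR (- t0).
  have mv : measurable_fun setT (fun x => v (ln (density s mu id x))).
    exact: measurable_comp_ln_density.
  have md := measurable_density s_gt0 mu mI.
  have h : (delta%:E * lebesgue_rV n [set: 'rV[R]_n] <=
      \int[lebesgue_rV n]_x (v (ln (density s mu id x)))%:E + c%:E)%E.
    have <- : (\int[lebesgue_rV n]_x (c%:E * (density s mu id x)%:E) = c%:E)%E.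
      rewrite ge0_integralZl//.
      - by rewrite integral_density// mule1.
      - exact/measurable_EFinP.
      - by move=> x _; rewrite lee_fin ltW// density_gt0.
      - by rewrite lee_fin mulr_ge0 ?expR_ge0// ltW.
    rewrite -ge0_integralD//.
    - rewrite -integral_cst//; apply: ge0_le_integral => //.
      + by move=> x _; rewrite lee_fin ltW.
      + apply: emeasurable_funD; first exact/measurable_EFinP.
        by apply/measurable_EFinP; exact: measurable_funM.
      move=> x _; rewrite -EFinM -EFinD lee_fin.
      have lx := ln_density_le s_gt0 mu x mI.
      have vx := v_ge0' _ lx.
      rewrite -[X in c * X]lnK ?posrE ?density_gt0//.
      set t := ln _ in vx *; rewrite /c -mulrA -expRD.
      have [tt|tt] := leP t t0.
        have := ft0 _ tt; rewrite -/(f t) => ft.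
        have : 0 <= beta * expR t by rewrite mulr_ge0 ?expR_ge0 ?normr_ge0.
        have : 0 <= delta * expR (- t0 + t) by rewrite mulr_ge0 ?expR_ge0// ltW.
        by rewrite /v; lra.
      rewrite -[leLHS]add0r lerD// ler_peMr ?(ltW d0)//.
      by rewrite -expR0 ler_expR addrC subr_ge0 ltW.
    - by move=> x _; rewrite lee_fin v_ge0'// ln_density_le.
    - exact/measurable_EFinP.
    - by move=> x _; rewrite lee_fin mulr_ge0 ?mulr_ge0 ?expR_ge0 ?(ltW d0)// ltW// density_gt0.
    - by apply/measurable_EFinP; exact: measurable_funM.
  move: h; rewrite lebesgue_rV_setT// gt0_muley ?lte_fin// leye_eq.
  by case: (\int[_]_x _)%E.
have v0 : v t @[t --> -oo] --> (0 : R).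
  rewrite -[X in _ --> X](subr0 0) -[X in _ --> X - _](mulr0 beta).
  by apply: cvgB => //; apply: cvgMl_tmp; exact: cvg_expR_Ny.
have cPhi j : continuous (iter j primitive v).
  by elim: j => [//|j IH]; exact: continuous_primitive.
pose Phi j := iter j primitive v.
have Phi_d j (t : R) : is_derive t 1 (Phi j.+1) (Phi j t).
  exact: (is_derive_primitive t (cPhi j)).
pose h (m : nat) : R := m.+1%:R^-1.
have h0 m : 0 < h m by rewrite invr_gt0.
have h1 m : h m <= 1 by rewrite invf_le1// ler1n.
pose D m t := fdiffn (h m) k (Phi k) t.
have mean m t : exists2 x, t <= x <= t + k%:R * h m & D m t = h m ^+ k * v x.
  exact: (fdiffn_mean Phi_d k t (ltW (h0 m))).
(* c m * D m is at most v because t |-> e^-t v t is nonincreasing. *)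
pose c m := expR (- (k%:R * h m)) / h m ^+ k.
have c0 m : 0 <= c m by rewrite divr_ge0 ?expR_ge0// exprn_ge0// ltW.
have D0 m t : t <= lmax s n -> 0 <= D m t.
  move=> tl; have [x /andP[tx xt] ->] := mean m t.
  rewrite mulr_ge0 ?exprn_ge0 ?(ltW (h0 m))// v_ge0// (le_trans xt)//.
  by rewrite lerD// ler_piMr.
have D_v m t : t <= lmax s n -> c m * D m t <= v t.
  move=> tl; have [x /andP[tx xt] ->] := mean m t.
  rewrite /c mulrA divfK; last by rewrite expf_neq0// gt_eqF.
  have vx : v x <= expR (x - t) * v t.
    have := ratio _ _ tx; rewrite -/(f t) -/(f x) /v => rtx.
    have -> : expR (x - t) * (beta * expR t - f t) =
        beta * expR x - expR x * (expR (- t) * f t).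
      rewrite mulrBr mulrCA -expRD subrK; congr (_ - _).
      by rewrite expRD mulrA.
    rewrite lerD2l lerN2 -ler_pdivlMl ?expR_gt0// -expRN.
    exact: rtx.
  rewrite expRN mulrC ler_pdivrMr ?expR_gt0// mulrC (le_trans vx)//.
  by rewrite ler_wpM2r ?v_ge0'// ler_expR lerBlDl.
have D_cvg t : c m * D m t @[m --> \oo] --> v t.
  (* One mean value point for each m; squeezed between t and t + k h, it tends to t. *)
  pose y m := projT1 (cid2 (mean m t)).
  have yP m : t <= y m <= t + k%:R * h m /\ D m t = h m ^+ k * v (y m).
    by rewrite /y; case: cid2.
  have hcv : h m @[m --> \oo] --> (0 : R) by exact: cvg_harmonic.
  have khcv : k%:R * h m @[m --> \oo] --> (0 : R).
    by rewrite -[X in _ --> X](mulr0 k%:R); apply: cvgMl_tmp; exact: hcv.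
  have ycv : y m @[m --> \oo] --> t.
    apply: (@squeeze_cvgr _ _ _ _ (cst t) (fun m => t + k%:R * h m)).
    - by apply: nearW => m; exact: (yP m).1.
    - exact: cvg_cst.
    - by rewrite -[X in _ --> X]addr0; apply: cvgD => //; exact: cvg_cst.
  rewrite (_ : (fun m => _) = (fun m => expR (- (k%:R * h m)) * v (y m))); last first.
    apply/funext => m; rewrite (yP m).2 /c mulrA divfK//.
    by rewrite expf_neq0// gt_eqF.
  have e1 : expR (- (k%:R * h m)) @[m --> \oo] --> (1 : R).
    have nkh : - (k%:R * h m) @[m --> \oo] --> (0 : R).
      by rewrite -[X in _ --> X]oppr0; apply: cvgN; exact: khcv.
    by rewrite -[X in _ --> X](@expR0 R); exact: (continuous_cvg _ (@continuous_expR R _) nkh).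
  rewrite -[X in _ --> X]mul1r; apply: cvgM; first exact: e1.
  exact: (continuous_cvg _ (@cv _) ycv).
(* The hypothesis on k enters here: the 2k Gaussian coordinates must include the n reserved for T
   y. *)
have nk : (n <= k.*2)%N by rewrite -leq_uphalf_double.
have Dc m : continuous (D m) by apply: continuous_fdiffn; exact: cPhi.
have mcD (X : 'rV[R]_n -> 'rV[R]_n) m : measurable_fun setT X ->
    measurable_fun setT (fun x => D m (ln (density s mu X x))).
  by move=> mX; exact: measurable_comp_ln_density.
have ZD (X : 'rV[R]_n -> 'rV[R]_n) m : measurable_fun setT X ->
    (\int[lebesgue_rV n]_x (c m * D m (ln (density s mu X x)))%:E =
     (c m)%:E * \int[lebesgue_rV n]_x (D m (ln (density s mu X x)))%:E)%E.
  move=> mX; under eq_integral do rewrite EFinM.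
  rewrite ge0_integralZl//; first by apply/measurable_EFinP; exact: mcD.
    by move=> x Dx; rewrite lee_fin D0// ln_density_le.
  by rewrite lee_fin.
(* Fatou in m on the side of T. At fixed m, [key] passes to the side of mu, where [D_v] gives c m D
   m <= v. *)
apply: (@le_integral_fatou _ _ _ _ (fun m x => c m * D m (ln (density s mu T x)))).
- by move=> m; apply: measurable_funM => //; exact: mcD.
- by move=> m x; rewrite mulr_ge0// D0// ln_density_le.
- by move=> x; exact: D_cvg.
move=> m; rewrite [leLHS](ZD _ _ mT).
have twist t u : t <= u -> expR (- u) * fdiffn (h m) k v u <= expR (- t) * fdiffn (h m) k v t.
  move=> tu; have := twisted_fdiffn_ndecr U_PCk (ltW (h0 m)) tu.
  (* The term beta e^t contributes the constant beta (e^h - 1)^k, so passing from f to v only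
     reverses the monotonicity. *)
  have E (z : R) : expR (- z) * fdiffn (h m) k v z =
      beta * (expR (h m) - 1) ^+ k - expR (- z) * fdiffn (h m) k f z.
    rewrite (_ : v = (fun t => beta * expR t + -1 * f t)); last first.
      by apply/funext => z'; rewrite mulN1r.
    rewrite (fdiffnD (h m) (fun t => beta * expR t) (fun t => -1 * f t)).
    rewrite !fdiffnZ fdiffn_expR expRN; field.
    by rewrite gt_eqF// expR_gt0.
  by rewrite !E lerD2l lerN2.
have key := fdiffn_contraction s_gt0 nk mu T_lip (ltW (h0 m)) Phi_d cv v0 twist (D0 m).
have cm0 : (0 <= (c m)%:E)%E by rewrite lee_fin.
apply: (le_trans (lee_wpmul2l cm0 key)).
rewrite -[leLHS](ZD _ _ mI).
apply: ge0_le_integral => //.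
- by move=> x _; rewrite lee_fin mulr_ge0// D0// ln_density_le.
- by apply/measurable_EFinP; apply: measurable_funM => //; exact: mcD.
- by apply/measurable_EFinP; exact: (measurable_comp_ln_density s_gt0 mu cv mI).
- by move=> x _; rewrite lee_fin D_v// ln_density_le.
Qed.
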